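(* Let $\mathbb{F}$ be a field and let $k\ge2$ be an integer. Let $C_n^2$ be the graph on $\{1,\ldots,n\}$ with edges $\{i,i+1\}$ and $\{i,i+2\}$ for $i=1,\ldots,n$, indices modulo $n$, and let $L_n^2$ be the graph on $\{1,\ldots,n\}$ with edges $\{i,i+1\}$ for $i=1,\ldots,n-1$ and $\{i,i+2\}$ for $i=1,\ldots,n-2$. Then $\mathbb{F}[\Delta_k^t(C^2_{3k})]$ and $\mathbb{F}[\Delta_k^t(L^2_{3k-2})]$ have linear resolutions. Moreover, $\mathbb{F}[\Delta_k^t(C^2_{3k})]$ is not Cohen-Macaulay, but $\mathbb{F}[\Delta_k^t(L^2_{3k-2})]$ is Cohen-Macaulay.
   Context: A simplicial complex on a finite set $V$ is a collection of subsets of $V$ closed under taking subsets (an element of $V$ need not itself be a face). Its Stanley-Reisner ring over $\mathbb{F}$ is $\mathbb{F}[\Delta]=S/I_\Delta$, where $S=\mathbb{F}[x_v : v\in V]$ (including variables for those $v$ that are not faces) and $I_\Delta$ is generated by the monomials $\prod_{v\in F}x_v$ for all $F\subseteq V$ with $F\notin\Delta$. For a finite simple graph $G=(V,E)$ and a positive integer $k$, $\Delta_k^t(G)$ is the simplicial complex on $V$ whose facets are the complements $V\setminus M$ of the independent sets $M\subseteq V$ of size $k$ (independent: no two elements adjacent). For a homogeneous ideal $I\subseteq S$, $\beta_{i,j}=\dim_{\mathbb{F}}\mathrm{Tor}^S_i(S/I,\mathbb{F})_j$ are the graded Betti numbers of $S/I$. $S/I$ has an $s$-linear resolution if $I$ is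 generated in degree $s$ and $\beta_{i,j}=0$ whenever $i\ge1$ and $j\ne s+i-1$; it has a linear resolution if it has an $s$-linear resolution for some $s\ge 1$. *)

(* Defs.v *)
(* MathComp world, with multinomials for the polynomial ring {mpoly F[n]}. *)
From HB Require Import structures.
From mathcomp Require Import all_boot all_order all_algebra.
From mathcomp Require Export mpoly.

Set Implicit Arguments.
Unset Strict Implicit.
Unset Printing Implicit Defensive.

Import GRing.Theory.
Local Open Scope ring_scope.

(** * Graphs and simplicial complexes *)

Record sgraph (T : finType) := SGraph {
  adj :> rel T;
  adj_sym : ssrbool.symmetric adj;
  adj_irr : irreflexive adj }.

Definition independent (T : finType) (G : sgraph T) (M : {set T}) : bool :=
  [forall x in M, forall y in M, ~~ G x y].

(* An element of T need not be a face, and the void complex (no face at all)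
   is allowed. *)
Record scomplex (T : finType) := SComplex {
  faces :> {set {set T}};
  faces_down : forall A B : {set T}, A \subset B -> B \in faces -> A \in faces }.

Definition faces_below (T : finType) (Fs : {set {set T}}) : {set {set T}} :=
  [set A : {set T} | [exists B in Fs, A \subset B]].

Lemma faces_below_down (T : finType) (Fs : {set {set T}}) (A B : {set T}) :
  A \subset B -> B \in faces_below Fs -> A \in faces_below Fs.
Proof.
move=> sAB; rewrite !inE => /existsP[C /andP[FsC sBC]].
by apply/existsP; exists C; rewrite FsC (subset_trans sAB sBC).
Qed.

Definition complex_below (T : finType) (Fs : {set {set T}}) : scomplex T :=
  SComplex (@faces_below_down T Fs).

(* The complements below all have the same cardinal, so none contains another
   and they are exactly the facets of the complex that they generate. *)
Definition total_cut_complex (T : finType) (k : nat) (G : sgraph T) :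
    scomplex T :=
  complex_below [set ~: M | M : {set T} & independent G M && (#|M| == k)].

(* In the next two graphs the vertex i : 'I_n stands for the vertex i + 1 of
   {1, ..., n}.  The condition i != j only matters when n <= 2, where
   i + 1 or i + 2 may be i itself modulo n. *)
Definition sqcycle_rel (n : nat) : rel 'I_n := fun i j =>
  (i != j) && [|| j == (i + 1) %% n :> nat, j == (i + 2) %% n :> nat,
                  i == (j + 1) %% n :> nat | i == (j + 2) %% n :> nat]%N.

Definition sqpath_rel (n : nat) : rel 'I_n := fun i j =>
  [|| j == i + 1 :> nat, j == i + 2 :> nat,
      i == j + 1 :> nat | i == j + 2 :> nat]%N.

Lemma sqcycle_sym n : ssrbool.symmetric (@sqcycle_rel n).
Proof.
move=> i j; rewrite /sqcycle_rel eq_sym; congr (_ && _).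
by do 4!case: (_ == _ :> nat).
Qed.

Lemma sqcycle_irr n : irreflexive (@sqcycle_rel n).
Proof. by move=> i; rewrite /sqcycle_rel eqxx. Qed.

Lemma sqpath_sym n : ssrbool.symmetric (@sqpath_rel n).
Proof. by move=> i j; rewrite /sqpath_rel; do 4!case: (_ == _ :> nat). Qed.

Lemma sqpath_irr n : irreflexive (@sqpath_rel n).
Proof.
by move=> i; rewrite /sqpath_rel -{1 3 5 7}[nat_of_ord i]addn0 !eqn_add2l.
Qed.

Definition sqcycle (n : nat) : sgraph 'I_n :=
  SGraph (@sqcycle_sym n) (@sqcycle_irr n).

Definition sqpath (n : nat) : sgraph 'I_n :=
  SGraph (@sqpath_sym n) (@sqpath_irr n).

(** * Ideals, Krull dimension and regular sequences *)

(* Ideals of a commutative ring R are predicates R -> Prop.  Notions about the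
   quotient R/I are written upstairs, in R: an ideal of R/I is an ideal of R
   that contains I, and an equality in R/I is a membership in I. *)
Section CommutativeAlgebra.

Variable R : comNzRingType.
Implicit Types (I J P : R -> Prop) (s : seq R).

Definition ideal_gen (G : R -> Prop) : R -> Prop := fun f =>
  exists m : nat, exists g : 'I_m -> R, exists c : 'I_m -> R,
    (forall i, G (g i)) /\ f = \sum_(i < m) c i * g i.

Definition is_ideal J : Prop :=
  [/\ J 0, forall f g, J f -> J g -> J (f + g) & forall f g, J g -> J (f * g)].

Definition prime_ideal P : Prop :=
  [/\ is_ideal P, ~ P 1 & forall f g, P (f * g) -> P f \/ P g].

(* A chain P 0 < P 1 < ... < P d of primes of R/I; P i is irrelevant for
   i > d. *)
Definition prime_chain I (d : nat) (P : nat -> R -> Prop) : Prop :=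
  [/\ forall i, (i <= d)%N -> prime_ideal (P i),
      forall i, (i <= d)%N -> forall f, I f -> P i f
    & forall i, (i < d)%N ->
        (forall f, P i f -> P i.+1 f) /\ (exists f, P i.+1 f /\ ~ P i f)].

Definition krull_dim I (d : nat) : Prop :=
  (exists P : nat -> R -> Prop, prime_chain I d P) /\
  (forall e (P : nat -> R -> Prop), prime_chain I e P -> (e <= d)%N).

(* I + (s) *)
Definition ideal_add I s : R -> Prop := ideal_gen (fun f => I f \/ f \in s).

(* s is a regular sequence on R/I *)
Definition regular_seq I s : Prop :=
  (forall i, (i < size s)%N -> forall f,
     ideal_add I (take i s) (nth 0 s i * f) -> ideal_add I (take i s) f) /\
  ~ ideal_add I s 1.

(* The grade of the ideal m on R/I *)
Definition grade (m I : R -> Prop) (d : nat) : Prop :=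
  (exists s, [/\ size s = d, forall x, x \in s -> m x & regular_seq I s]) /\
  (forall s, (forall x, x \in s -> m x) -> regular_seq I s -> (size s <= d)%N).

End CommutativeAlgebra.

(** * Graded quotients of the polynomial ring *)

Section GradedQuotients.

Variables (F : fieldType) (n : nat).
Local Notation S := {mpoly F[n]}.
Implicit Types (I : S -> Prop) (i j : nat).

(* The graded maximal ideal (x_1, ..., x_n) *)
Definition irrelevant_ideal : S -> Prop := fun f => f@_0%MM = 0.

(* The usual definition for a standard graded algebra: the depth (that is, the
   grade of the graded maximal ideal) is equal to the Krull dimension. *)
Definition cohen_macaulay I : Prop :=
  exists d : nat, krull_dim I d /\ grade irrelevant_ideal I d.

(* A sequence of graded free modules C_i = \bigoplus_l S(- gshift l), with l in
   'I_(grk i), elements of C_i being row vectors, and of maps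
   gdif i : C_(i+1) -> C_i, v |-> v *m gdif i, preserving degrees; also a
   degree-preserving map gaug from C_0 to S, whose composition with S -> S/I
   is used as an augmentation. *)
Record graded_free_seq := GradedFreeSeq {
  grk : nat -> nat;
  gshift : forall i, 'I_(grk i) -> nat;
  gdif : forall i, 'M[S]_(grk i.+1, grk i);
  gaug : 'cV[S]_(grk 0);
  gdif_homog : forall i k l m,
    m \in msupp (gdif i k l) -> gshift k = (gshift l + mdeg m)%N;
  gaug_homog : forall l m, m \in msupp (gaug l 0) -> gshift l = mdeg m }.

(* ... -> C_2 -> C_1 -> C_0 -> S/I -> 0 is exact. *)
Definition is_resolution I (C : graded_free_seq) : Prop :=
  [/\ exists v : 'rV[S]_(grk C 0), I ((v *m gaug C) 0 0 - 1),
      forall v : 'rV[S]_(grk C 0),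
        I ((v *m gaug C) 0 0) <-> exists w, v = w *m gdif C 0
    & forall i (v : 'rV[S]_(grk C i.+1)),
        v *m gdif C i = 0 <-> exists w, v = w *m gdif C i.+1].

Section TensorHomology.

Variable C : graded_free_seq.

(* The complex C \otimes_S F, where F = S/(x_1, ..., x_n) *)
Definition dif0 i : 'M[F]_(grk C i.+1, grk C i) :=
  map_mx (mcoeff 0%MM) (gdif C i).

(* Its degree j component, as a row space: it is spanned by the basis vectors
   of degree j *)
Definition deg_part i j : 'M[F]_(grk C i) :=
  diag_mx (\row_l (gshift l == j)%:R).

Definition cycles i j : 'M[F]_(grk C i) :=
  match i return 'M[F]_(grk C i) with
  | 0%N => deg_part 0 j
  | i'.+1 => (deg_part i'.+1 j :&: kermx (dif0 i'))%MS
  end.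

Definition boundaries i j : 'M[F]_(grk C i.+1, grk C i) :=
  deg_part i.+1 j *m dif0 i.

Definition tor_dim i j : nat := (\rank (cycles i j) - \rank (boundaries i j))%N.

End TensorHomology.

(* graded_betti I i j b: b = dim_F Tor^S_i(S/I, F)_j, where Tor is computed
   from a graded free resolution of S/I (the result does not depend on it). *)
Definition graded_betti I i j (b : nat) : Prop :=
  exists C, is_resolution I C /\ tor_dim C i j = b.

Definition generated_in_degree I (s : nat) : Prop :=
  forall f, I f -> ideal_gen (fun g => I g /\ g \is s.-homog) f.

Definition s_linear_resolution I (s : nat) : Prop :=
  generated_in_degree I s /\
  forall i j, (1 <= i)%N -> j <> (s + i - 1)%N -> graded_betti I i j 0.

Definition linear_resolution I : Prop :=
  exists s : nat, (1 <= s)%N /\ s_linear_resolution I s.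

End GradedQuotients.

(* I_Delta, so that F[Delta] = S/I_Delta *)
Definition stanley_reisner_ideal (F : fieldType) (n : nat)
    (Delta : scomplex 'I_n) : {mpoly F[n]} -> Prop :=
  ideal_gen (fun f : {mpoly F[n]} =>
    exists A : {set 'I_n}, A \notin Delta /\ f = \prod_(v in A) 'X_v).
Arguments stanley_reisner_ideal F {n} Delta.

(* Main.v *)
(* An independent set has at most one vertex in each block {3a, 3a + 1, 3a + 2}
   (vertices being numbered from 0), so the independent k-sets are the residue classes
   modulo 3 of C^2_{3k} and the single class of 0 in L^2_{3k-2}.  Hence I_Delta
   is the ideal P_0 P_1 P_2, respectively P_0, where P_r is generated by the
   variables of the r-th class; it is generated by the transversals of 3,
   respectively 1, colour classes.

   Linearity: the transversals are the bases of a (poly)matroid, so, listed in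
   lexicographic order, they have linear quotients, and iterated mapping cones
   produce a linear resolution.

   L^2: the quotient is a polynomial ring.  If J_0 <= ... <= J_d are ideals with
   x_i in J_(i+1) regular modulo J_i and J_d proper, then the monomials in the
   x_i are linearly independent modulo J_0; counting monomials bounds d by the
   number of variables.  Applied to chains of primes and to regular sequences,
   this bounds the dimension and the depth at once.

   C^2: the Koszul cocycle of degree 2 given by +-X_i X_j for i, j in the
   classes 1 and 2 is not a coboundary modulo P_0 P_1 P_2, so the depth is at
   most 2, while the dimension is at least 3. *)
Require Import Defs.
From mathcomp Require Import all_boot all_order all_algebra.
From mathcomp Require Import zify ring.

Set Implicit Arguments.
Unset Strict Implicit.
Unset Printing Implicit Defensive.

Import GRing.Theory.
Local Open Scope ring_scope.

(** * Linear resolutions by mapping cones *)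

Section LinearResolutions.

Variables (F : fieldType) (n : nat).
Local Notation S := {mpoly F[n]}.
Implicit Types (I J K : S -> Prop).

Definition mxhomog d a b (A : 'M[S]_(a, b)) := forall i j, A i j \is d.-homog.

Definition mxexact a b c (D : 'M[S]_(c, a)) (A : 'M[S]_(a, b)) :=
  forall v : 'rV_a, v *m A = 0 <-> exists w, v = w *m D.

(* The kernel of A has a free resolution of length l with linear matrices. *)
Fixpoint lres l a b (A : 'M[S]_(a, b)) : Prop :=
  if l is l'.+1 then
    exists c (D : 'M[S]_(c, a)), [/\ mxhomog 1 D, mxexact D A & lres l' D]
  else forall v : 'rV_a, v *m A = 0 -> v = 0.

Lemma lres_injective l a b (A : 'M[S]_(a, b)) :
  (forall v : 'rV_a, v *m A = 0 -> v = 0) -> lres l A.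
Proof.
elim: l a b A => [|l IHl] a b A injA //=.
exists 0%N, 0; split=> [[]//|v|].
  split=> [/injA->|[w ->]]; first by exists 0; rewrite mul0mx.
  by rewrite mulmx0 mul0mx.
by apply: IHl => v _; apply/rowP; case.
Qed.

Lemma leq_lres l l' a b (A : 'M[S]_(a, b)) :
  (l <= l')%N -> lres l A -> lres l' A.
Proof.
elim: l l' a b A => [|l IHl] [|l'] a b A //=.
  by move=> _ /(@lres_injective l'.+1).
move=> le_ll' [c [D [D1 DA lD]]].
by exists c, D; split=> //; apply: IHl lD.
Qed.

Lemma pihomogMr d e (p q : S) : q \is e.-homog ->
  pihomog mdeg d p * q = pihomog mdeg (d + e) (p * q).
Proof.
move=> qe; pose k := maxn (msize p) d.+1.
have ltdk : (d < k)%N by rewrite leq_max leqnn orbT.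
rewrite {2}(pihomog_partitionE (mf := mdeg) (leq_maxl (msize p) d.+1)).
rewrite [in RHS]mulr_suml raddf_sum /= (bigD1 (Ordinal ltdk)) //= big1 ?addr0.
  by rewrite [RHS]pihomog_dE //; apply: dhomogM => //; apply: pihomogP.
move=> i ne_id; apply: (@pihomog_ne0 _ _ mdeg (i + e)%N).
  by rewrite eqn_add2r.
by apply: dhomogM => //; apply: pihomogP.
Qed.

Lemma homog_lift d e a b c (A : 'M[S]_(a, b)) (H : 'M[S]_(c, b)) :
    mxhomog d A -> mxhomog (e + d) H ->
    (forall i, exists u, row i H = u *m A) ->
  exists2 U : 'M[S]_(c, a), mxhomog e U & H = U *m A.
Proof.
move=> Ad Hed /fin_all_exists[u Hu].
exists (\matrix_(i, j) pihomog mdeg e (u i 0 j)).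
  by move=> i j; rewrite mxE pihomogP.
apply/matrixP=> i j; have /rowP/(_ j) := Hu i; rewrite !mxE => Hij.
rewrite -(pihomog_dE (Hed i j)) Hij raddf_sum; apply: eq_bigr => l _.
by rewrite mxE (pihomogMr _ _ (Ad l j)).
Qed.

Lemma mxexact_mul a b c (D : 'M[S]_(c, a)) (A : 'M[S]_(a, b)) :
  mxexact D A -> D *m A = 0.
Proof.
move=> DA; apply/row_matrixP=> i; rewrite row_mul row0.
by apply/DA; exists (delta_mx 0 i); rewrite rowE.
Qed.

(** The kernel of the block matrix is an extension of the kernel of [E] by that of [A], because [P]
    sends the first into the image of [A]. Lifting [P] to the next syzygies gives a block matrix of
    the same shape, so the induction continues. *)
Lemma lres_cone l a b e f (A : 'M[S]_(a, b)) (E : 'M[S]_(e, f))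
    (P : 'M[S]_(e, b)) :
    mxhomog 1 A -> mxhomog 1 P -> mxhomog 1 E ->
    (forall v : 'rV_e, v *m E = 0 -> exists u, v *m P = u *m A) ->
  lres l A -> lres l E -> lres l (block_mx A 0 P E).
Proof.
elim: l a b e f A E P => [|l IHl] a b e f A E P A1 P1 E1 EP /=.
  move=> injA injE v; rewrite -[v]hsubmxK mul_row_block mulmx0 add0r.
  move/eqP; rewrite row_mx_eq0 => /andP[/eqP vA /eqP/injE vE].
  by move: vA; rewrite vE mul0mx addr0 => /injA ->; rewrite row_mx0.
move=> [c [D [D1 DA lD]]] [g [B [B1 BE lB]]].
have [DA0 BE0] := (mxexact_mul DA, mxexact_mul BE).
have [Q Q1 BP] : exists2 Q : 'M[S]_(g, a), mxhomog 1 Q & B *m P = Q *m A.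
  apply: homog_lift A1 _ _ => [i j|i]; last first.
    by rewrite row_mul; apply: EP; rewrite -row_mul BE0 row0.
  by rewrite mxE rpred_sum // => l' _; rewrite dhomogM.
exists (c + g)%N, (block_mx D 0 (- Q) B); split.
- move=> i j; rewrite -(splitK i) -(splitK j).
  case: (split i) => i'; case: (split j) => j';
    rewrite ?(block_mxEul, block_mxEur, block_mxEdl, block_mxEdr) //.
    by rewrite mxE rpred0.
  by rewrite mxE rpredN.
- move=> v; split=> [|[w ->]].
    rewrite -[v]hsubmxK mul_row_block mulmx0 add0r.
    set v1 := lsubmx v; set v2 := rsubmx v.
    move/eqP; rewrite row_mx_eq0 => /andP[/eqP vA /eqP/BE[w2 v2E]].
    have /DA[w1 w1E] : (v1 + w2 *m Q) *m A = 0.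
      by rewrite mulmxDl -mulmxA -BP mulmxA -v2E.
    exists (row_mx w1 w2); rewrite mul_row_block mulmx0 add0r -w1E -v2E.
    by rewrite mulmxN addrK.
  rewrite -[w]hsubmxK !mul_row_block !mulmx0 !add0r mulmxDl mulmxN mulNmx.
  by rewrite -!mulmxA DA0 BE0 BP mulmx0 add0r addNr mulmx0 row_mx0.
- apply: IHl => //.
  + by move=> i j; rewrite mxE rpredN.
  + move=> v vB; have /DA[w Dw] : v *m - Q *m A = 0.
      by rewrite mulmxN mulNmx -mulmxA -BP mulmxA vB mul0mx oppr0.
    by exists w.
Qed.

(** A form of having an [s]-linear resolution that is stable under mapping cones; [linres_s_linear]
    converts it into vanishing Betti numbers. *)
Definition linres s J := exists l a (G : 'cV[S]_a),
  [/\ mxhomog s G, forall f, J f <-> exists w : 'rV_a, f = (w *m G) 0 0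
    & lres l G].

Lemma eq_linres s I J : (forall f, I f <-> J f) -> linres s J -> linres s I.
Proof.
move=> eqIJ [l [a [G [Gs JG lG]]]]; exists l, a, G; split=> // f.
by rewrite eqIJ.
Qed.

Lemma linres_zero s : linres s (fun f : S => f = 0).
Proof.
exists 0%N, 0%N, 0; split=> [[]//|f|v _]; last by apply/rowP; case.
split=> [->|[w ->]]; last by rewrite mulmx0 mxE.
by exists 0; rewrite mul0mx mxE.
Qed.

(* The mapping cone: multiplication by g identifies S/(J : g), shifted by s,
   with (J + (g))/J. *)
Lemma linres_colon s J K (g : S) :
    g \is s.-homog -> linres s J -> linres 1 K ->
    (forall f, J (f * g) <-> K f) ->
  linres s (fun f => exists h, J (f - h * g)).
Proof.
move=> gs [l1 [a [G [Gs JG lG]]]] [l2 [e [E [E1 KE lE]]]] JgK.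
pose l := maxn l1 l2.
have [c [D [D1 DG lD]]] : lres l.+1 G.
  by apply: leq_lres lG; rewrite leqW ?leq_maxl.
have {}lE : lres l E by apply: leq_lres lE; rewrite leq_maxr.
(* [P] lifts multiplication by [g] from the generators of [K] to those of [J]; comparing the degrees
   [1 + s] and [s] makes it linear. *)
have [P P1 EP] : exists2 P : 'M[S]_(e, a), mxhomog 1 P & g *: E = P *m G.
  apply: homog_lift Gs _ _ => [i j|i].
    by rewrite mxE addnC; apply: dhomogM.
  have /JgK/JG[u Eu] : K (E i 0) by apply/KE; exists (delta_mx 0 i); rewrite -rowE mxE.
  by exists u; apply/rowP=> j; rewrite !ord1 -Eu !mxE mulrC.
have DG0 := mxexact_mul DG.
exists l.+1, (a + 1)%N, (col_mx G g%:M); split.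
- move=> i j; rewrite -(splitK i) !ord1; case: (split i) => i' /=.
    by rewrite col_mxEu.
  by rewrite col_mxEd ord1 mxE eqxx.
- move=> f; split=> [[h /JG[w fE]]|[w ->]].
    exists (row_mx w h%:M); rewrite mul_row_col mxE -fE -scalar_mxM mxE eqxx.
    by rewrite subrK.
  exists (rsubmx w 0 0); apply/JG; exists (lsubmx w).
  rewrite -{1}[w]hsubmxK mul_row_col mxE.
  by rewrite [rsubmx w]mx11_scalar -scalar_mxM !mxE eqxx addrK.
exists (c + e)%N, (block_mx D 0 (- P) E); split.
- move=> i j; rewrite -(splitK i) -(splitK j).
  case: (split i) => i'; case: (split j) => j';
    rewrite ?(block_mxEul, block_mxEur, block_mxEdl, block_mxEdr) //.
    by rewrite mxE rpred0.
  by rewrite mxE rpredN.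
- move=> v; split=> [|[w ->]].
    rewrite -[v]hsubmxK mul_row_col.
    set v1 := lsubmx v; set v2 := rsubmx v => vG.
    have /KE[w2 v2E] : K (v2 0 0).
      apply/JgK/JG; exists (- v1); rewrite mulNmx.
      rewrite (eqP (_ : - (v1 *m G) == v2 *m g%:M)); last first.
        by rewrite eq_sym -addr_eq0 addrC vG.
      by rewrite [v2]mx11_scalar -scalar_mxM !mxE eqxx.
    have {}v2E : v2 = w2 *m E by rewrite [v2]mx11_scalar v2E -mx11_scalar.
    have /DG[w1 w1E] : (v1 + w2 *m P) *m G = 0.
      by rewrite mulmxDl -mulmxA -EP -scalemxAr -v2E -mul_mx_scalar.
    exists (row_mx w1 w2); rewrite mul_row_block mulmx0 add0r -w1E -v2E.
    by rewrite mulmxN addrK.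
  rewrite -[w]hsubmxK mul_row_block mulmx0 add0r mul_row_col mulmxDl.
  rewrite -!mulmxA DG0 mulmx0 add0r mul_mx_scalar EP mulNmx mulmxN.
  by rewrite addNr.
- apply: lres_cone => // [i j|v vE]; first by rewrite mxE rpredN.
  have /DG[w Dw] : v *m - P *m G = 0.
    by rewrite mulmxN mulNmx -mulmxA -EP -scalemxAr vE scaler0 oppr0.
  by exists w.
Qed.

(** The finite resolution is padded with modules of rank 0, since [graded_free_seq] is indexed by
    all natural numbers. *)
Lemma lres_sequence l a b (A : 'M[S]_(a, b)) : lres l A ->
  exists (r : nat -> nat) (D0 : 'M[S]_(r 0, a))
         (D : forall i, 'M[S]_(r i.+1, r i)),
    [/\ mxhomog 1 D0, forall i, mxhomog 1 (D i), mxexact D0 A,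
        mxexact (D 0) D0 & forall i, mxexact (D i.+1) (D i)].
Proof.
elim: l a b A => [|l IHl] a b A /=.
  move=> injA; exists (fun=> 0%N), 0, (fun=> 0).
  have exact0 c d (D : 'M[S]_(c, 0)) (B : 'M[S]_(0, d)) : mxexact D B.
    split=> [_|_]; first by exists 0; apply/rowP; case.
    by rewrite [B]flatmx0 mulmx0.
  split=> [[]|? []|v||i] //; split=> [/injA->|[w ->]].
    by exists 0; rewrite mul0mx.
  by rewrite mulmx0 mul0mx.
move=> [c [D [D1 DA /IHl[r [D0 [D' [D01 D'1 D0D D'D0 D'D']]]]]]].
pose r' (j : nat) := if j is i'.+1 then r i' else c.
exists r', D.
exists (fun i => match i return 'M_(r' i.+1, r' i) with
                 | 0%N => D0 | i'.+1 => D' i' end).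
by split=> // [[|i]|[|i]] //=.
Qed.

(** With generators of degree [s] and linear matrices, the free module in position [i >= 1] lives
    only in degree [s + i - 1]; in any other degree there are no cycles. *)
Lemma linres_s_linear s J : linres s J -> s_linear_resolution J s.
Proof.
move=> [l [a [G [Gs JG lG]]]]; split=> [f /JG[w ->]|i j i_gt0 ne_j].
  exists a, (fun i => G i 0), (fun i => w 0 i); rewrite mxE; split=> // i.
  by split=> //; apply/JG; exists (delta_mx 0 i); rewrite -rowE mxE.
have [r [D0 [D [D01 D1 D0G DD0 DD]]]] := lres_sequence lG.
pose rk i := match i with 0%N => 1%N | 1%N => a | i'.+2 => r i' end.
pose sh i (_ : 'I_(rk i)) := if i is i'.+1 then (s + i')%N else 0%N.
pose dif i := match i return 'M[S]_(rk i.+1, rk i) with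
              | 0%N => G | 1%N => D0 | i'.+2 => D i' end.
have dif_homog p k k' m : m \in msupp (dif p k k') ->
    sh p.+1 k = (sh p k' + mdeg m)%N.
  rewrite /sh; case: p k k' => [|[|p]] /= k k' m_in.
  - by rewrite ord1 in m_in; rewrite (dhomog_mf (Gs _ _) m_in) addn0.
  - by rewrite (dhomog_mf (D01 _ _) m_in) addn0.
  - by rewrite (dhomog_mf (D1 _ _ _) m_in) addn1 addnS.
have aug_homog l' m : m \in msupp ((1%:M : 'cV[S]_(rk 0)) l' 0) ->
    sh 0 l' = mdeg m.
  by rewrite !ord1 mxE eqxx msupp1 inE => /eqP->; rewrite mdeg0.
exists (GradedFreeSeq dif_homog aug_homog); split.
  split=> /=.
  - exists 1%:M; rewrite mulmx1 mxE eqxx subrr.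
    by apply/JG; exists 0; rewrite mul0mx mxE.
  - move=> v; rewrite mulmx1 JG; split=> [[w vE]|[w ->]]; last by exists w.
    by exists w; apply/rowP=> k; rewrite ord1.
  - by move=> [|[|p]] v; [apply: D0G | apply: DD0 | apply: DD].
case: i i_gt0 ne_j => // i _ ne_j; rewrite /tor_dim /=.
rewrite (_ : deg_part _ _ _ = 0) ?cap0mx ?mxrank0 //.
apply/matrixP=> k k'; rewrite !mxE /= /sh.
by case: eqP => [jE|]; rewrite ?mul0rn //; case: ne_j; rewrite -jE addnS subn1.
Qed.

End LinearResolutions.

(** * Monomial ideals with linear quotients *)

Section MonomialIdeals.

Variables (F : fieldType) (n : nat).
Local Notation S := {mpoly F[n]}.
Implicit Types (D : pred 'X_{1..n}) (L : seq 'X_{1..n}) (f : S) (g m l : 'X_{1..n}).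

(** The span of the monomials in [D], an ideal as soon as [D] is closed under multiples; membership
    becomes a test on supports. *)
Definition mono_ideal D f : Prop := {in msupp f, forall m, D m}.

Lemma mono_idealX D m : mono_ideal D ('X_[m] : S) <-> D m.
Proof.
split=> [|Dm m']; first by apply; rewrite msuppX inE.
by rewrite msuppX inE => /eqP->.
Qed.

Lemma eq_mono_ideal D1 D2 f : D1 =1 D2 -> mono_ideal D1 f <-> mono_ideal D2 f.
Proof. by move=> eqD; split=> Df m /Df; rewrite eqD. Qed.

Lemma mono_ideal_sum D (T : Type) (r : seq T) (P : pred T) (f_ : T -> S) :
    (forall i, P i -> mono_ideal D (f_ i)) ->
  mono_ideal D (\sum_(i <- r | P i) f_ i).
Proof.
move=> Df; elim/big_rec: _ => [m|i f /Df Dfi IHf m]; first by rewrite msupp0.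
by move/msuppD_le; rewrite mem_cat => /orP[/Dfi|/IHf].
Qed.

Lemma mono_ideal_is_ideal D :
  (forall m m', D m -> D (m + m')%MM) -> is_ideal (mono_ideal D).
Proof.
move=> upD; split=> [m|f g Df Dg m|f g Dg m]; first by rewrite msupp0.
  by move/msuppD_le; rewrite mem_cat => /orP[/Df|/Dg].
by move/msuppM_le/allpairsP=> [[m1 m2] [/= _ /Dg Dm2 ->]]; rewrite addmC upD.
Qed.

Lemma mono_ideal_mulX D f (g : 'X_{1..n}) :
  mono_ideal D (f * 'X_[g]) <-> mono_ideal (fun m => D (m + g)%MM) f.
Proof.
split=> Df m.
  move=> fm; apply: Df; rewrite (perm_mem (msuppMX f g)) addmC.
  exact: map_f.
by rewrite (perm_mem (msuppMX f g)) => /mapP[m' /Df Dm' ->]; rewrite addmC.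
Qed.

Definition multiple_of L : pred 'X_{1..n} := fun m => has (fun l => (l <= m)%MM) L.

Lemma multiple_ofP L m :
  reflect (exists2 l, l \in L & (l <= m)%MM) (multiple_of L m).
Proof. exact: hasP. Qed.

Lemma mono_ideal_cons (g : 'X_{1..n}) L f :
  mono_ideal (multiple_of (g :: L)) f <->
  exists h, mono_ideal (multiple_of L) (f - h * 'X_[g]).
Proof.
split=> [Lf|[h Lh] m fm].
  (* The cofactor collects the terms of [f] divisible by the monomial [g], divided by it. *)
  exists (\sum_(m <- msupp f | (g <= m)%MM) f@_m *: 'X_[m - g]).
  rewrite {1}[f]mpolyE (bigID (fun m => (g <= m)%MM)) /= mulr_suml.
  rewrite addrAC -sumrB big1 ?add0r => [|m le_gm]; last first.
    by rewrite -scalerAl -mpolyXD submK // subrr.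
  rewrite big_seq_cond; apply: mono_ideal_sum => m /andP[fm /negPf gm] m'.
  move/msuppZ_le; rewrite msuppX inE => /eqP->.
  by have:= Lf _ fm; rewrite /multiple_of /= gm.
rewrite /multiple_of /=; case: (boolP (g <= m)%MM) => //= gm.
apply: Lh; rewrite mcoeff_msupp mcoeffB.
rewrite (memN_msupp_eq0 (m := m) (p := h * _)) ?subr0 -?mcoeff_msupp //.
apply: contra gm; rewrite (perm_mem (msuppMX h g)) => /mapP[m' _ ->].
by apply/mnm_lepP=> i; rewrite mnmDE leq_addr.
Qed.

Lemma mono_ideal_nil f : mono_ideal (multiple_of [::]) f <-> f = 0.
Proof.
split=> [L0|-> m]; last by rewrite msupp0.
apply: msuppnil0; case fE: (msupp f) => [//|m r].
by have := L0 m; rewrite fE mem_head => /(_ isT).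
Qed.

(** A variable is regular modulo the ideal of other variables, so each colon ideal is the previous
    ideal itself. *)
Lemma linres_variables (W : seq 'I_n) : uniq W ->
  linres 1 (@mono_ideal (multiple_of [seq U_(v)%MM | v <- W])).
Proof.
elim: W => [_|v W IHW /= /andP[vW /IHW linW]].
  exact: eq_linres mono_ideal_nil (linres_zero _ _ _).
apply: eq_linres (mono_ideal_cons _ _) _.
apply: (linres_colon _ linW linW) => [|f]; first by rewrite dhomogX /= mdeg1.
rewrite mono_ideal_mulX; apply: eq_mono_ideal => m.
rewrite /multiple_of !has_map; apply: eq_in_has => w wW /=.
rewrite !lep1mP mnmDE mnm1E; case: (v =P w) => [vE|_]; last by rewrite addn0.
by rewrite vE wW in vW.
Qed.

(** The colon ideal of the smaller generators by [g] is generated by the l / gcd(l, g). The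
    hypothesis provides a variable in this colon ideal that divides l / gcd(l, g), so variables
    generate it and [linres_colon] applies. The list decreases so that its tail holds the smaller
    generators. *)
Lemma linres_linear_quotients s L :
    sorted (fun m m' => (m' < m)%O) L -> {in L, forall m, mdeg m = s} ->
    {in L &, forall g l, (l < g)%O ->
       exists v g', [/\ g' \in L, (g' < g)%O, (g' <= g + U_(v))%MM
                      & (g v < l v)%N]} ->
  linres s (@mono_ideal (multiple_of L)).
Proof.
elim: L => [_ _ _|g L IHL sortL sL lqL].
  exact: eq_linres mono_ideal_nil (linres_zero _ _ _).
have ltLg : {in L, forall l, (l < g)%O}.
  apply/allP; apply: order_path_min sortL => x y z yx xz.
  exact: Order.POrderTheory.lt_trans xz yx.
apply: eq_linres (mono_ideal_cons _ _) _.
pose W := enum [pred v | multiple_of L (g + U_(v))%MM].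
have linW := linres_variables (enum_uniq [pred v | multiple_of L (g + U_(v))%MM]).
apply: (linres_colon _ _ linW) => [||f].
- by rewrite dhomogX /= sL ?mem_head.
- apply: IHL => [|m Lm|h l Lh Ll /lqL[||v [g' [Lg' g'h g'v hv]]]].
  + exact: path_sorted sortL.
  + by rewrite sL // inE Lm orbT.
  + by rewrite inE Lh orbT.
  + by rewrite inE Ll orbT.
  exists v, g'; split=> //; move: Lg'; rewrite inE => /orP[/eqP g'E|//].
  have := Order.POrderTheory.lt_trans g'h (ltLg h Lh).
  by rewrite g'E Order.POrderTheory.ltxx.
rewrite mono_ideal_mulX; apply: eq_mono_ideal => m.
apply/multiple_ofP/multiple_ofP => [[l Ll lm]|[_ /mapP[v + ->]]].
  have [||v [g' [Lg' g'g g'v gv]]] := lqL g l _ _ (ltLg _ Ll).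
  - exact: mem_head.
  - by rewrite inE Ll orbT.
  exists U_(v)%MM.
    apply: map_f; rewrite mem_enum inE; apply/multiple_ofP; exists g' => //.
    move: Lg'; rewrite inE => /orP[/eqP g'E|//].
    by rewrite g'E Order.POrderTheory.ltxx in g'g.
  rewrite lep1mP -lt0n; move/mnm_lepP/(_ v): lm; rewrite mnmDE => lv.
  by rewrite -(ltn_add2r (g v)) add0n (leq_trans gv).
rewrite mem_enum inE => /multiple_ofP[l Ll lv] vm; exists l => //.
apply: lepm_trans lv _; apply/mnm_lepP=> i; rewrite !mnmDE addnC leq_add2r.
exact: (mnm_lepP vm).
Qed.

(** In equal degrees the order is lexicographic. If [p] is the first place where [l < g] differ, an
    exchange at [p] brings in some [q] after [p], so the new generator is smaller than [g] and
    divides g X_q. *)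
Lemma linres_polymatroidal s L :
    {in L, forall m, mdeg m = s} ->
    {in L &, forall m m' p, (m' p < m p)%N ->
       exists2 q, (m q < m' q)%N & (m - U_(p) + U_(q))%MM \in L} ->
  linres s (@mono_ideal (multiple_of L)).
Proof.
move=> sL exL; pose L' := rev (sort <=%O (undup L)).
have memL' : L' =i L by move=> m; rewrite mem_rev mem_sort mem_undup.
apply: (@eq_linres _ _ s _ (mono_ideal (multiple_of L'))) => [f|].
  by apply: eq_mono_ideal => m; rewrite /multiple_of (eq_has_r memL').
apply: linres_linear_quotients => [|m|g l].
- rewrite rev_sorted.
  by have := Order.TotalTheory.sort_lt_sorted (undup L); rewrite undup_uniq.
- by rewrite memL' => /sL.
rewrite !memL' => Lg Ll; have degE := etrans (sL l Ll) (esym (sL g Lg)).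
case/(ltmcP degE) => p ltp lgp; have [q gq Lg'] := exL _ _ Lg Ll _ lgp.
have ne_qp : q != p by apply: contraTneq lgp => <-; rewrite -leqNgt ltnW.
have le_pq : (p < q)%N.
  case: ltngtP ne_qp => // [/ltp eq_q|/val_inj->]; last by rewrite eqxx.
  by rewrite eq_q ltnn in gq.
exists q, (g - U_(p) + U_(q))%MM; split=> //; rewrite ?memL' //.
  apply/ltmcP; first by rewrite !sL.
  exists p => [j ltjp|]; rewrite mnmDE mnmBE !mnm1E.
    by rewrite -!val_eqE /= !gtn_eqF ?subn0 ?addn0 // (ltn_trans ltjp).
  by rewrite eqxx (negPf ne_qp) addn0 subn1 prednK // (leq_ltn_trans _ lgp).
by apply/mnm_lepP=> i; rewrite !mnmDE mnmBE leq_add2r leq_subr.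
Qed.

End MonomialIdeals.

(** * Chains of ideals and regular elements *)

Section RegularChains.

Variables (F : fieldType) (n : nat).
Local Notation S := {mpoly F[n]}.
Implicit Types (J : nat -> S -> Prop) (x : nat -> S).

Definition regular_chain d J x : Prop :=
  [/\ forall i, (i <= d)%N -> is_ideal (J i),
      forall i f, (i < d)%N -> J i f -> J i.+1 f,
      forall i, (i < d)%N -> J i.+1 (x i)
    & forall i f, (i < d)%N -> J i (x i * f) -> J i f].

Lemma regular_chainS d J x :
  regular_chain d.+1 J x -> regular_chain d (J \o succn) (x \o succn).
Proof.
move=> [idJ subJ Jx regx].
by split=> i *; [apply: idJ | apply: subJ | apply: Jx | apply: regx].
Qed.

Lemma is_ideal_sum (R : comNzRingType) (I : R -> Prop) (T : Type) (r : seq T)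
    (P : pred T) (f_ : T -> R) :
  is_ideal I -> (forall i, P i -> I (f_ i)) -> I (\sum_(i <- r | P i) f_ i).
Proof. by case=> I0 ID _ If; elim/big_rec: _ => // i f /If/ID; apply. Qed.

Lemma is_idealB (R : comNzRingType) (I : R -> Prop) f g :
  is_ideal I -> I f -> I g -> I (f - g).
Proof. by case=> _ ID IM If Ig; apply: ID => //; rewrite -mulN1r; apply: IM. Qed.

(* In a vanishing combination of monomials in x, factor out the least power of
   x 0: the terms where it is attained form a combination of monomials in
   x 1, x 2, ... that vanishes modulo J 1. *)
Lemma regular_chain_dependent (T : finType) d J x (A : {set T}) (u : T -> F)
    (e : T -> nat -> nat) :
    regular_chain d J x -> A != set0 -> {in A, forall t, u t != 0} ->
    {in A &, forall t t', (forall i, (i < d)%N -> e t i = e t' i) -> t = t'} ->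
    J 0 (\sum_(t in A) u t *: \prod_(i < d) x i ^+ e t i) ->
  J d 1.
Proof.
elim: d J x A e => [|d IHd] J x A e chainJ A0 u0 injA.
  have [t At] := set0Pn _ A0; have [/(_ 0%N isT)[_ _ JM] _ _ _] := chainJ.
  rewrite (big_pred1 t) => [|t'].
    rewrite big_ord0 => Ju; have := JM ((u t)^-1)%:MP _ Ju.
    by rewrite mul_mpolyC scalerA mulVf ?scale1r ?u0.
  by apply/idP/eqP=> [At'|->//]; apply: injA.
have [t0 At0] := set0Pn _ A0.
case: (arg_minnP (fun t => e t 0%N) At0) => t1 At1 min_t1.
change (is_true (t1 \in A)) in At1.
set m := e t1 0%N in min_t1.
have [idJ subJ Jx regx] := chainJ.
have idJ1 : is_ideal (J 1) by apply: idJ.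
have [_ J1D J1M] := idJ1.
have regXn k f : J 0 (x 0%N ^+ k * f) -> J 0 f.
  by elim: k => [|k IHk]; rewrite ?mul1r // exprS -mulrA => /regx-/(_ isT).
pose P t := \prod_(i < d) x i.+1 ^+ e t i.+1.
rewrite (eq_bigr (fun t => x 0%N ^+ m * (u t *: (x 0%N ^+ (e t 0%N - m) * P t)))).
  rewrite -mulr_sumr => /regXn/subJ-/(_ isT).
  rewrite (bigID (fun t => e t 0%N == m)) /= => Jq.
  apply: (IHd _ _ [set t in A | e t 0%N == m] (fun t i => e t i.+1)
            (regular_chainS chainJ)) => [|t|t t'|].
  - by apply/set0Pn; exists t1; rewrite inE At1 eqxx.
  - by rewrite inE => /andP[/u0].
  - rewrite !inE => /andP[At /eqP tm] /andP[At' /eqP tm'] eqe.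
    by apply: injA => // -[|i] ltid; [rewrite tm tm' | apply: eqe].
  rewrite /= (eq_bigl (fun t => (t \in A) && (e t 0%N == m))) => [|t]; last first.
    by rewrite inE.
  rewrite (eq_bigr (fun t => u t *: (x 0%N ^+ (e t 0%N - m) * P t))); last first.
    by move=> t /andP[_ /eqP->]; rewrite subnn mul1r.
  set q2 := (\sum_(t in A | ~~ _) _) in Jq.
  rewrite -[X in J 1 X](addrK q2); apply: is_idealB => //.
  apply: is_ideal_sum => // t /andP[At ne_m].
  have lt_m : (m < e t 0%N)%N by rewrite ltn_neqAle eq_sym ne_m min_t1.
  rewrite -(subnSK lt_m) exprSr -mul_mpolyC -mulrA mulrA mulrCA.
  by rewrite mulrC; apply: J1M; apply: Jx.
move=> t /min_t1 le_m; rewrite -scalerAr mulrA -exprD subnKC // big_ord_recl.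
by [].
Qed.

Lemma mono_ideal_sub (D : pred 'X_{1..n}) (I : S -> Prop) f :
    is_ideal I -> (forall m, D m -> I 'X_[m]) -> mono_ideal D f -> I f.
Proof.
move=> idI DI Df; rewrite [f]mpolyE big_seq; apply: is_ideal_sum => // m /Df/DI.
by rewrite -mul_mpolyC; case: idI => _ _; apply.
Qed.

Lemma mdeg_msupp_prod (d : nat) x (e : nat -> nat) :
  {in msupp (\prod_(i < d) x i ^+ e i), forall m,
     (mdeg m <= \sum_(i < d) e i * msize (x i))%N}.
Proof.
have mulP f g a b : {in msupp f, forall m, (mdeg m <= a)%N} ->
    {in msupp g, forall m, (mdeg m <= b)%N} ->
    {in msupp (f * g : S), forall m, (mdeg m <= a + b)%N}.
  move=> fa gb m /msuppM_le/allpairsP[[m1 m2] [/= /fa le1 /gb le2 ->]].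
  by rewrite mdegD leq_add.
have oneP : {in msupp (1 : S), forall m, (mdeg m <= 0)%N}.
  by move=> m; rewrite msupp1 inE => /eqP->; rewrite mdeg0.
elim: d => [|d IHd]; first by rewrite !big_ord0.
rewrite !big_ord_recr /=; apply: (mulP _ _ _ _ IHd).
elim: (e d) => [|k IHk] //; rewrite exprS mulSn; apply: mulP IHk.
by move=> m /msize_mdeg_lt/ltnW.
Qed.

Lemma regular_chain_length d J x (W : {set 'I_n}) :
    regular_chain d J x -> {in W, forall v, J 0 'X_v} -> ~ J d 1 ->
  (d <= n - #|W|)%N.
Proof.
move=> chainJ JW J1; rewrite leqNgt; apply/negP=> lt_d; case: J1.
set c := (n - #|W|)%N in lt_d.
(* The products of the [x i] with exponents below [N] have degree below [B = N * D]. There are N^d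
   of them, against B^c = N^c D^c exponent vectors below [B] outside [W]; since N > D^c and d > c,
   the products win. *)
pose D := (\sum_(i < d) msize (x i)).+1.
pose N := (D ^ c).+1; pose B := (N * D)%N.
pose T := {ffun 'I_d -> 'I_N}.
pose C := {ffun {v : 'I_n | v \in ~: W} -> 'I_B}.
have cardC : #|{: C}| = (B ^ c)%N.
  by rewrite card_ffun card_ord card_sig cardsCs setCK card_ord.
have ltCT : (#|{: C}| < #|{: T}|)%N.
  rewrite cardC card_ffun !card_ord expnMn.
  apply: leq_trans (_ : N ^ c * N <= _)%N; first by rewrite ltn_mul2l expn_gt0 /=.
  by rewrite -expnSr leq_pexp2l.
pose e (t : T) i := if insub i is Some i' then val (t i') else 0%N.
have eE (t : T) (i : 'I_d) : e t i = t i by rewrite /e valK.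
pose y t := \prod_(i < d) x i ^+ e t i.
pose mm (k : C) := [multinom (if insub v is Some w then val (k w) else 0%N) | v < n].
(* Rows are products and columns are monomials outside [W]. A nonzero vector of the left kernel is a
   linear relation modulo the variables of [W], hence modulo [J 0]. *)
pose A := \matrix_(i < #|{: T}|, j < #|{: C}|) (y (enum_val i))@_(mm (enum_val j)).
have : kermx A != 0.
  rewrite kermx_eq0 /row_free neq_ltn (leq_ltn_trans (rank_leq_col A)) //.
case/rowV0Pn=> w /sub_kermxP wA w0.
pose u t := w 0 (enum_rank t).
apply: (regular_chain_dependent (A := [set t | u t != 0]) (u := u) (e := e) chainJ).
- apply: contra w0 => /eqP supp0; apply/eqP/rowP=> i; rewrite mxE.
  have := in_set0 (enum_val i); rewrite -supp0 inE /u enum_valK => /negbFE/eqP.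
  by [].
- by move=> t; rewrite inE.
- move=> t t' _ _ eqe; apply/ffunP=> i; apply/val_inj.
  by have := eqe i (ltn_ord i); rewrite !eE.
have [/(_ 0%N isT) idJ0 _ _ _] := chainJ.
apply: (mono_ideal_sub (D := fun m => [exists v in W, m v != 0%N]) idJ0).
  move=> m /exists_inP[v Wv mv]; rewrite -(submK (m := U_(v)) (m' := m)) ?lep1mP //.
  by rewrite mpolyXD; case: idJ0 => _ _; apply; apply: JW.
move=> m; apply: contraLR => /exists_inPn mW.
rewrite -mcoeff_eq0.
have [lt_m|ge_m] := ltnP (mdeg m) B; last first.
  rewrite raddf_sum /= big1 // => t _; rewrite mcoeffZ memN_msupp_eq0 ?mulr0 //.
  apply: contraL ge_m => /mdeg_msupp_prod; rewrite -ltnNge => le_m.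
  apply: (leq_ltn_trans le_m).
  apply: leq_ltn_trans (_ : \sum_(i < d) N * msize (x i) < _)%N.
    by apply: leq_sum => i _; rewrite leq_mul2r eE ltnW ?orbT.
  by rewrite -big_distrr /= ltn_mul2l /=.
have lt_mv v : (m v < B)%N.
  by apply: leq_ltn_trans lt_m; rewrite mdegE (bigD1 v) //= leq_addr.
pose k : C := [ffun v => Ordinal (lt_mv (val v))].
have mE : m = mm k.
  apply/mnmP=> v; rewrite mnmE; case: insubP => [v' _ v'E|].
    by rewrite ffunE /= v'E.
  by rewrite inE negbK => /mW; rewrite negbK => /eqP.
have /rowP/(_ (enum_rank k)) := wA; rewrite !mxE => wAk.
rewrite -[X in _ == X]wAk raddf_sum /= (reindex_onto enum_val enum_rank) /=; last first.
  by move=> t _; rewrite enum_rankK.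
rewrite [X in _ == X](bigID (fun i => w 0 i != 0)) /= [X in _ == _ + X]big1 ?addr0.
  rewrite [X in X == _](eq_bigl (fun i => w 0 i != 0)) => [|i]; last first.
    by rewrite inE /u enum_valK eqxx andbT.
  by apply/eqP/eq_bigr=> i _; rewrite mxE mcoeffZ /u enum_valK enum_rankK -mE.
by move=> i /negbNE/eqP->; rewrite mul0r.
Qed.

End RegularChains.

(** * Ideals generated by variables *)

Section IdealGeneration.

Variable R : comNzRingType.
Implicit Types (G I : R -> Prop) (s : seq R).

Lemma mem_ideal_gen G g : G g -> ideal_gen G g.
Proof.
move=> Gg; exists 1%N, (fun=> g), (fun=> 1).
by rewrite big_ord1 mul1r.
Qed.

Lemma ideal_gen_is_ideal G : is_ideal (ideal_gen G).
Proof.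
split=> [|_ _ [m1 [g1 [c1 [G1 ->]]]] [m2 [g2 [c2 [G2 ->]]]]|].
- by exists 0%N, (fun=> 0), (fun=> 0); split=> [[]//|]; rewrite big_ord0.
- exists (m1 + m2)%N.
  exists (fun i => match split i with inl j => g1 j | inr j => g2 j end).
  exists (fun i => match split i with inl j => c1 j | inr j => c2 j end).
  split=> [i|]; first by case: (split i).
  rewrite big_split_ord /=; congr (_ + _); apply: eq_bigr => i _.
    by rewrite (unsplitK (inl i)).
  by rewrite (unsplitK (inr i)).
- move=> f _ [m [g [c [Gg ->]]]]; exists m, g, (fun i => f * c i).
  by split=> //; rewrite mulr_sumr; apply: eq_bigr => i _; rewrite mulrA.
Qed.

Lemma ideal_gen_sub G I f :
  is_ideal I -> (forall g, G g -> I g) -> ideal_gen G f -> I f.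
Proof.
move=> idI GI [m [g [c [Gg ->]]]]; apply: is_ideal_sum => // i _.
by case: idI => _ _; apply; apply: GI.
Qed.

Lemma ideal_add_is_ideal I s : is_ideal (ideal_add I s).
Proof. exact: ideal_gen_is_ideal. Qed.

Lemma ideal_add_nil I f : is_ideal I -> ideal_add I [::] f <-> I f.
Proof.
move=> idI; split=> [|If]; last by apply: mem_ideal_gen; left.
by apply: ideal_gen_sub => // g [].
Qed.

Lemma ideal_add_rcons I s x f :
  ideal_add I (rcons s x) f -> exists a, ideal_add I s (f - a * x).
Proof.
have [J0 JD JM] := ideal_add_is_ideal I s.
pose K f := exists a, ideal_add I s (f - a * x).
apply: (@ideal_gen_sub _ K) => [|g].
  split=> [|g h [a Ja] [b Jb]|g h [a Ja]].
  - by exists 0; rewrite mul0r subr0.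
  - by exists (a + b); rewrite mulrDl opprD addrACA; apply: JD.
  - by exists (g * a); rewrite -mulrA -mulrBr; apply: JM.
case=> [Ig|]; first by exists 0; rewrite mul0r subr0; apply: mem_ideal_gen; left.
rewrite mem_rcons inE => /orP[/eqP->|sg]; first by exists 1; rewrite mul1r subrr.
by exists 0; rewrite mul0r subr0; apply: mem_ideal_gen; right.
Qed.

End IdealGeneration.

(** * Dimension and depth of quotients by variables *)

Section RegularSequences.

Variables (F : fieldType) (n : nat).
Local Notation S := {mpoly F[n]}.
Implicit Types (I : S -> Prop) (W : {set 'I_n}).

Lemma regular_seq_chain I s :
  regular_seq I s ->
  regular_chain (size s) (fun i => ideal_add I (take i s)) (nth 0 s).
Proof.
move=> [regs _]; split=> [i _|i f lt_i|i lt_i|i f lt_i]; last exact: regs.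
- exact: ideal_add_is_ideal.
- apply: ideal_gen_sub => [|g]; first exact: ideal_add_is_ideal.
  rewrite (take_nth 0 lt_i) => -[Ig|sg]; apply: mem_ideal_gen; [by left|right].
  by rewrite mem_rcons inE sg orbT.
- by apply: mem_ideal_gen; right; rewrite (take_nth 0 lt_i) mem_rcons mem_head.
Qed.

(** An element of a prime [P i.+1] outside the prime [P i] is regular modulo [P i]. *)
Lemma prime_chain_regular I d (P : nat -> S -> Prop) :
  prime_chain I d P -> exists x, regular_chain d P x.
Proof.
move=> [primeP _ stepP].
have /fin_all_exists[x Px] (i : 'I_d) : exists f, P i.+1 f /\ ~ P i f.
  by have [] := stepP i (ltn_ord i).
exists (fun i => if insub i is Some i' then x i' else 0).
split=> [i le_i|i f lt_i|i lt_i|i f lt_i].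
- by have [] := primeP i le_i.
- by have [subP _] := stepP i lt_i; apply: subP.
- by rewrite insubT; have [] := Px (Ordinal lt_i).
have [_ _ /(_ _ _)] := primeP i (ltnW lt_i); rewrite insubT => primePi.
by case/primePi=> //; have [_] := Px (Ordinal lt_i).
Qed.

Definition var_ideal W : S -> Prop :=
  mono_ideal (fun m => [exists v in W, m v != 0%N]).

Lemma var_idealX W v : var_ideal W 'X_v <-> v \in W.
Proof.
rewrite /var_ideal mono_idealX; split=> [/exists_inP[w Ww]|Wv].
  by rewrite mnm1E eqb0 negbK => /eqP->.
by apply/exists_inP; exists v; rewrite ?mnm1E ?eqxx.
Qed.

Lemma var_ideal_is_ideal W : is_ideal (var_ideal W).
Proof.
apply: mono_ideal_is_ideal => m m' /exists_inP[v Wv mv].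
by apply/exists_inP; exists v; rewrite // mnmDE addn_eq0 negb_and mv.
Qed.

Lemma var_ideal_sub W I f :
  is_ideal I -> {in W, forall v, I 'X_v} -> var_ideal W f -> I f.
Proof.
move=> idI IW; apply: mono_ideal_sub => // m /exists_inP[v Wv mv].
rewrite -(submK (m := U_(v)) (m' := m)) ?lep1mP // mpolyXD.
by case: idI => _ _; apply; apply: IW.
Qed.

Definition kill_vars W : S -> S :=
  mmap (@mpolyC n F) (fun v => if v \in W then 0 else 'X_v).

Lemma kill_varsM W f g : kill_vars W (f * g) = kill_vars W f * kill_vars W g.
Proof. exact: (rmorphM (mmap (@mpolyC n F) _)). Qed.

Lemma kill_vars_eq0 W f : kill_vars W f = 0 <-> var_ideal W f.
Proof.
pose inW (m : 'X_{1..n}) := [exists v in W, m v != 0%N].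
have killX m : mmap1 (fun v => if v \in W then 0 else 'X_v : S) m =
    if inW m then 0 else 'X_[m].
  rewrite /inW; case: exists_inP => [[v Wv mv]|offW].
    by rewrite /mmap1 (bigD1 v) //= Wv expr0n (negPf mv) mul0r.
  rewrite mpolyXE_id; apply: eq_bigr => v _; case: ifP => // Wv.
  by case: (eqVneq (m v) 0%N) => [->//|mv]; case: offW; exists v.
have -> : kill_vars W f = \sum_(m <- msupp f | ~~ inW m) f@_m *: 'X_[m].
  rewrite /kill_vars /mmap [RHS]big_mkcond /=; apply: eq_bigr => m _.
  by rewrite killX mul_mpolyC; case: (inW m); rewrite ?scaler0.
split=> [sum0|Wf]; last first.
  by rewrite big1_seq // => m /andP[/negP inWm /Wf].
rewrite [f]mpolyE (bigID inW) /= sum0 addr0; apply: mono_ideal_sum => m Wm m'.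
by move/msuppZ_le; rewrite msuppX inE => /eqP->.
Qed.

Lemma var_ideal1 W : ~ var_ideal W 1.
Proof.
move=> /(_ 0%MM); rewrite msupp1 mem_head => /(_ isT)/exists_inP[v _].
by rewrite mnm0E.
Qed.

(** This ideal is the kernel of [kill_vars W], a ring morphism into an integral domain. *)
Lemma var_ideal_prime W : prime_ideal (var_ideal W).
Proof.
split=> [||f g]; [exact: var_ideal_is_ideal | exact: var_ideal1 |].
rewrite -!kill_vars_eq0 kill_varsM => /eqP; rewrite mulf_eq0.
by case/orP=> /eqP; [left | right].
Qed.

(** The chain adjoins the variables outside [W] one at a time. *)
Lemma var_ideal_chain I W :
    (forall f, I f -> var_ideal W f) ->
  exists P, prime_chain I #|~: W| P.
Proof.
move=> subIW; pose r := enum (~: W); pose V i := W :|: [set v in take i r].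
exists (fun i => var_ideal (V i)); split=> [i _|i _ f /subIW|i].
- exact: var_ideal_prime.
- apply: var_ideal_sub => [|v Wv]; first exact: var_ideal_is_ideal.
  by apply/var_idealX; rewrite inE Wv.
rewrite cardE -/r => lt_i.
have v0 : 'I_n by case: (r) lt_i.
pose w := nth v0 r i; have r_w : w \in r by apply: mem_nth.
split=> [f|].
  apply: var_ideal_sub => [|v]; first exact: var_ideal_is_ideal.
  rewrite !inE => Vv; apply/var_idealX; rewrite !inE (take_nth v0 lt_i).
  by rewrite mem_rcons inE; case/orP: Vv => ->; rewrite ?orbT.
exists 'X_w; rewrite !var_idealX !inE (take_nth v0 lt_i) mem_rcons mem_head orbT.
split=> //; have := r_w; rewrite mem_enum inE => /negPf-> /=.
have := enum_uniq (~: W); rewrite -/r -{1}(cat_take_drop i r) cat_uniq.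
case/and3P=> _ /hasPn/(_ w) + _; rewrite (drop_nth v0 lt_i) mem_head.
by move/(_ isT)=> /negP.
Qed.

Lemma ideal_add_vars I W (r : seq 'I_n) f :
    (forall f, I f <-> var_ideal W f) ->
  ideal_add I [seq 'X_v | v <- r] f <-> var_ideal (W :|: [set v in r]) f.
Proof.
move=> IW; split.
  apply: ideal_gen_sub => [|g [/IW|/mapP[v rv ->]]].
  - exact: var_ideal_is_ideal.
  - apply: var_ideal_sub => [|v Wv]; first exact: var_ideal_is_ideal.
    by apply/var_idealX; rewrite inE Wv.
  - by apply/var_idealX; rewrite !inE rv orbT.
apply: var_ideal_sub => [|v]; first exact: ideal_add_is_ideal.
rewrite !inE => /orP[Wv|rv]; apply: mem_ideal_gen.
  by left; apply/IW/var_idealX.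
by right; apply: map_f.
Qed.

(** The variables outside [W] give both a chain of primes and a regular sequence of length
    [#|~: W|]; [regular_chain_length] shows that neither can be longer. *)
Lemma cohen_macaulay_var_ideal I W :
  (forall f, I f <-> var_ideal W f) -> cohen_macaulay I.
Proof.
move=> IW; have cardW : (n - #|W|)%N = #|~: W| by rewrite [RHS]cardsCs setCK card_ord.
have I_W v : v \in W -> I 'X_v by move=> Wv; apply/IW/var_idealX.
exists #|~: W|; split; split.
- by apply: var_ideal_chain => f /IW.
- move=> e P chainP; have [x regP] := prime_chain_regular chainP.
  have [primeP subP _] := chainP.
  rewrite -cardW; apply: regular_chain_length regP _ _ => [v /I_W|]; first exact: subP.
  by have [] := primeP e (leqnn e).
- exists [seq 'X_v | v <- enum (~: W)]; split.
  + by rewrite size_map -cardE.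
  + move=> _ /mapP[v _ ->]; rewrite /irrelevant_ideal mcoeffX.
    by rewrite mnm1_eq0.
  split=> [i|]; last by rewrite ideal_add_vars //; apply: var_ideal1.
  rewrite size_map => lt_i f; rewrite -map_take.
  have v0 : 'I_n by case: (enum _) lt_i.
  rewrite (nth_map v0) // !ideal_add_vars //.
  have [_ _ primeW] := var_ideal_prime (W :|: [set v in take i (enum (~: W))]).
  case/primeW=> // /var_idealX; rewrite !inE.
  have: nth v0 (enum (~: W)) i \in enum (~: W) by apply: mem_nth.
  rewrite mem_enum inE => /negPf-> /=.
  have := enum_uniq (~: W); rewrite -{1}(cat_take_drop i (enum _)) cat_uniq.
  case/and3P=> _ /hasPn/(_ (nth v0 (enum (~: W)) i)) + _.
  by rewrite (drop_nth v0 lt_i) mem_head => /(_ isT)/negP.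
- move=> s _ regs; have [_ s1] := regs.
  rewrite -cardW; apply: regular_chain_length (regular_seq_chain regs) _ _ => [v Wv|].
    by apply: mem_ideal_gen; left; apply: I_W.
  by rewrite take_size.
Qed.

End RegularSequences.

(** * Koszul cohomology and depth *)

Section KoszulCocycles.

Variables (F : fieldType) (n : nat).
Local Notation S := {mpoly F[n]}.
Implicit Types (J : nat -> S -> Prop) (x : nat -> S).

(** The properties of a regular sequence in the graded maximal ideal that the Koszul long exact
    sequences of multiplication by [x i] rely on. *)
Definition local_chain d J x : Prop :=
  [/\ regular_chain d J x,
      forall i f, (i < d)%N -> J i.+1 f -> exists a, J i (f - a * x i)
    & forall i, (i < d)%N -> irrelevant_ideal (x i)].

Lemma local_chainS d J x :
  local_chain d.+1 J x -> local_chain d (J \o succn) (x \o succn).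
Proof.
case=> [/regular_chainS chainJ genJ irrx]; split=> // i *; last exact: irrx.
exact: genJ.
Qed.

Lemma irrelevant_sum (f : S) :
  irrelevant_ideal f -> exists c : 'I_n -> S, f = \sum_j c j * 'X_j.
Proof.
move=> f0; pose K f := exists c : 'I_n -> S, f = \sum_j c j * 'X_j.
apply: (@var_ideal_sub F n setT K) => [|v _|m].
- split=> [|_ _ [c ->] [d ->]|g _ [c ->]].
  + by exists (fun=> 0); rewrite big1 // => i _; rewrite mul0r.
  + exists (fun i => c i + d i); rewrite -big_split /=.
    by apply: eq_bigr => i _; rewrite mulrDl.
  + exists (fun i => g * c i); rewrite mulr_sumr.
    by apply: eq_bigr => i _; rewrite mulrA.
- exists (fun i => (i == v)%:R); rewrite (bigD1 v) //= eqxx mul1r big1 ?addr0 //.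
  by move=> i /negPf->; rewrite mul0r.
rewrite mcoeff_msupp; apply: contraR => /exists_inPn mT.
suff -> : m = 0%MM by apply/eqP.
by apply/mnmP=> v; have := mT v (in_setT v); rewrite mnm0E negbK => /eqP.
Qed.

(* The next three lemmas say that H^0, H^1 and H^2 of the Koszul complex of
   X_1, ..., X_n on S/J_0 vanish.  Since x_0 lies in (X_1, ..., X_n), it kills
   Koszul cohomology, so H^i(S/J_0) is a quotient of H^(i-1)(S/J_1). *)
Lemma koszul0 d J x (g : S) :
  local_chain d.+1 J x -> (forall i, J 0 ('X_i * g)) -> J 0 g.
Proof.
move=> [[idJ _ _ regx] _ irrx] Jg; have idJ0 := idJ 0%N isT.
have [c x0E] := irrelevant_sum (irrx 0%N isT).
apply: (regx 0%N) => //; rewrite x0E mulr_suml; apply: is_ideal_sum => // i _.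
by rewrite -mulrA; case: idJ0 => _ _; apply.
Qed.

Lemma koszul1 d J x (g : 'I_n -> S) :
    local_chain d.+2 J x -> (forall i j, J 0 ('X_i * g j - 'X_j * g i)) ->
  exists h, forall j, J 0 (g j - 'X_j * h).
Proof.
move=> chainJ Jg; have [[idJ subJ Jx regx] genJ irrx] := chainJ.
have idJ0 := idJ 0%N isT; have [_ JD JM] := idJ0.
have [c x0E] := irrelevant_sum (irrx 0%N isT).
(* Contraction with [c] is the homotopy by which [x 0] kills the class of [g]: modulo [J 0],
   [x 0 * g i] is ['X_i * e]. *)
pose e := \sum_i c i * g i.
have Je i : J 0 (x 0 * g i - 'X_i * e).
  have -> : x 0 * g i - 'X_i * e = \sum_j c j * ('X_j * g i - 'X_i * g j).
    by rewrite x0E mulr_suml mulr_sumr -sumrB; apply: eq_bigr => j _; ring.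
  by apply: is_ideal_sum => // j _; apply: (JM).
(* Modulo [J 1] every variable kills [e], so [koszul0] puts [e] in [J 1]. Dividing by [x 0] modulo
   [J 0] gives the primitive of [g]. *)
have [a Ja] : exists a, J 0 (e - a * x 0).
  apply: genJ => //; apply: (koszul0 (local_chainS chainJ)) => i /=.
  have -> : 'X_i * e = g i * x 0 - (x 0 * g i - 'X_i * e) by ring.
  apply: is_idealB; [exact: idJ | | exact: subJ].
  by have [_ _ J1M] := idJ 1%N isT; apply: (J1M); apply: Jx.
exists a => j; apply: (regx 0%N) => //.
have -> : x 0 * (g j - 'X_j * a) = x 0 * g j - 'X_j * e + 'X_j * (e - a * x 0).
  by ring.
by apply: (JD) => //; apply: (JM).
Qed.

Lemma koszul2 d J x (g : 'I_n -> 'I_n -> S) :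
    local_chain d.+3 J x ->
    (forall i j k, J 0 ('X_i * g j k - 'X_j * g i k + 'X_k * g i j)) ->
  exists h, forall i j, J 0 (g i j - ('X_i * h j - 'X_j * h i)).
Proof.
move=> chainJ Jg; have [[idJ subJ Jx regx] genJ irrx] := chainJ.
have idJ0 := idJ 0%N isT; have [_ JD JM] := idJ0.
have [c x0E] := irrelevant_sum (irrx 0%N isT).
pose e j := \sum_i c i * g i j.
have Je j k : J 0 (x 0 * g j k - ('X_j * e k - 'X_k * e j)).
  have -> : x 0 * g j k - ('X_j * e k - 'X_k * e j) =
      \sum_i c i * ('X_i * g j k - 'X_j * g i k + 'X_k * g i j).
    rewrite x0E mulr_suml !mulr_sumr -!sumrB; apply: eq_bigr => i _; ring.
  by apply: is_ideal_sum => // i _; apply: (JM).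
(* The contraction [e] is a 1-cocycle modulo [J 1], hence the coboundary of some [b]. Subtracting it
   and dividing by [x 0] modulo [J 0] gives the primitive [a] of [g]. *)
have [b Jb] : exists b, forall k, J 1 (e k - 'X_k * b).
  apply: (koszul1 (local_chainS chainJ)) => j k /=.
  have -> : 'X_j * e k - 'X_k * e j =
      g j k * x 0 - (x 0 * g j k - ('X_j * e k - 'X_k * e j)) by ring.
  apply: is_idealB; [exact: idJ | | exact: subJ].
  by have [_ _ J1M] := idJ 1%N isT; apply: (J1M); apply: Jx.
have /fin_all_exists[a Ja] k : exists a, J 0 (e k - 'X_k * b - a * x 0).
  exact: genJ.
exists a => i j; apply: (regx 0%N) => //.
have -> : x 0 * (g i j - ('X_i * a j - 'X_j * a i)) =
    x 0 * g i j - ('X_i * e j - 'X_j * e i) + 'X_i * (e j - 'X_j * b - a j * x 0)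
    + (- 'X_j) * (e i - 'X_i * b - a i * x 0) by ring.
by apply: (JD); [apply: (JD) => // |]; apply: (JM).
Qed.

Lemma regular_seq_local_chain (I : S -> Prop) s :
    (forall f, f \in s -> irrelevant_ideal f) -> regular_seq I s ->
  local_chain (size s) (fun i => ideal_add I (take i s)) (nth 0 s).
Proof.
move=> irrs regs; split=> [|i f lt_i|i lt_i].
- exact: regular_seq_chain.
- by rewrite (take_nth 0 lt_i) => /ideal_add_rcons.
- by apply: irrs; apply: mem_nth.
Qed.

End KoszulCocycles.

(** * Squarefree transversal ideals *)

Section ColouredIdeals.

Variables (F : fieldType) (n t : nat) (c : 'I_n -> nat).
Local Notation S := {mpoly F[n]}.

Implicit Types (m : 'X_{1..n}).

(** With residues modulo 3 as colours, [t = 3] serves the cycle, and [t = 1], where only colour 0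
    counts, serves the path. *)
Definition rainbow (m : 'X_{1..n}) : bool :=
  [forall r : 'I_t, exists v, (c v == r) && (m v != 0%N)].

Lemma rainbowP (m : 'X_{1..n}) :
  reflect (forall r, (r < t)%N -> exists2 v, c v = r & m v != 0%N) (rainbow m).
Proof.
apply: (iffP forallP) => [cm r lt_r|cm r].
  by have /existsP[v /andP[/eqP cv mv]] := cm (Ordinal lt_r); exists v.
by have [v cv mv] := cm r (ltn_ord r); apply/existsP; exists v; rewrite cv eqxx.
Qed.

Definition rainbow_ideal : S -> Prop := mono_ideal rainbow.

Lemma rainbow_add m m' : rainbow m -> rainbow (m + m')%MM.
Proof.
move/rainbowP=> cm; apply/rainbowP=> r /cm[v cv mv]; exists v => //.
by rewrite mnmDE addn_eq0 negb_and mv.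
Qed.

Lemma rainbow_ideal_is_ideal : is_ideal rainbow_ideal.
Proof. by apply: mono_ideal_is_ideal => m m'; apply: rainbow_add. Qed.

Definition colour_deg r (m : 'X_{1..n}) := (\sum_(v | c v == r) m v)%N.

Lemma colour_degD r m m' :
  colour_deg r (m + m')%MM = (colour_deg r m + colour_deg r m')%N.
Proof. by rewrite -big_split /=; apply: eq_bigr => v _; rewrite mnmDE. Qed.

Lemma colour_deg1 r v : colour_deg r U_(v)%MM = (c v == r).
Proof.
rewrite /colour_deg; case: eqP => [cv|ne_cv].
  rewrite (bigD1 v) ?cv //= mnm1E eqxx big1 // => w /andP[_ ne_w].
  by rewrite mnm1E eq_sym (negPf ne_w).
rewrite big1 // => w /eqP cw; rewrite mnm1E.
by case: eqP => // vw; case: ne_cv; rewrite vw.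
Qed.

Lemma sum_colour_deg m :
  (\sum_(r < t) colour_deg r m = \sum_(v | c v < t) m v)%N.
Proof.
rewrite (exchange_big_dep (fun v => c v < t)%N) /= => [|r v _ /eqP->//].
apply: eq_bigr => v lt_v; rewrite (big_pred1 (Ordinal lt_v)) //.
Qed.

Definition transversal_mnm (m : 'X_{1..n}) : bool :=
  (mdeg m == t) && [forall r : 'I_t, colour_deg r m == 1%N].

(** Monomials of degree at most [t] form a finite type, hence can be enumerated. *)
Definition transversals : seq 'X_{1..n} :=
  [seq m <- [seq bmnm m | m : 'X_{1..n < t.+1}] | transversal_mnm m].

Lemma mem_transversals m : (m \in transversals) = transversal_mnm m.
Proof.
rewrite mem_filter andb_idr // => /andP[/eqP mt _].
have lt_m : (mdeg m < t.+1)%N by rewrite mt.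
by apply/imageP; exists (BMultinom lt_m).
Qed.

Lemma transversal_mnmP m :
  reflect (mdeg m = t /\ forall r, (r < t)%N -> colour_deg r m = 1%N)
          (transversal_mnm m).
Proof.
apply: (iffP andP) => [[/eqP mt /forallP mr]|[mt mr]].
  by split=> // r lt_r; apply/eqP/(mr (Ordinal lt_r)).
by rewrite mt; split=> //; apply/forallP=> r; rewrite mr.
Qed.

(** The colours below [t] already account for the whole degree [t]. *)
Lemma transversal_mnm_colour m v : transversal_mnm m -> m v != 0%N -> (c v < t)%N.
Proof.
case/transversal_mnmP=> mt mr mv; rewrite ltnNge; apply: contra mv => ge_cv.
have sum_mr : (\sum_(r < t) colour_deg r m = t)%N.
  by rewrite (eq_bigr (fun=> 1%N)) ?sum1_card ?card_ord // => r _; apply: mr.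
have := mt; rewrite mdegE (bigID (fun v => c v < t)%N) /= -sum_colour_deg sum_mr.
rewrite (bigD1 v) /= -?leqNgt //.
by rewrite -[RHS]addn0 => /addnI/eqP; rewrite addn_eq0 => /andP[].
Qed.

Lemma multiple_of_transversals m : multiple_of transversals m = rainbow m.
Proof.
apply/multiple_ofP/rainbowP => [[l + le_lm] r lt_r|cm].
  rewrite mem_transversals => /transversal_mnmP[_ /(_ r lt_r) deg1].
  have : colour_deg r l != 0%N by rewrite deg1.
  rewrite sum_nat_eq0 => /forallPn[v]; rewrite negb_imply => /andP[/eqP cv lv].
  by exists v => //; rewrite -lt0n (leq_trans _ (mnm_lepP le_lm v)) ?lt0n.
have /fin_all_exists2[f cf mf] (r : 'I_t) : exists2 v, c v = r & m v != 0%N.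
  exact: cm.
(* One variable of each colour dividing [m] is chosen; their colours differ, so the product is
   squarefree and divides [m]. *)
exists (\sum_(r < t) U_(f r))%MM.
  rewrite mem_transversals; apply/transversal_mnmP; split=> [|r lt_r].
    rewrite mdeg_sum (eq_bigr (fun=> 1%N)) ?sum1_card ?card_ord // => r _.
    exact: mdeg1.
  rewrite (big_morph _ (colour_degD r) (_ : _ = 0%N)); last first.
    by rewrite /colour_deg big1 // => v _; rewrite mnm0E.
  rewrite (bigD1 (Ordinal lt_r)) //= colour_deg1 cf eqxx big1 // => r' ne_r'.
  by rewrite colour_deg1 cf; apply/eqP; rewrite eqb0.
apply/mnm_lepP=> v; rewrite mnm_sumE.
case: (pickP (fun r => f r == v)) => [r0 /eqP fr0|f_v].
  rewrite (bigD1 r0) //= mnm1E fr0 eqxx big1 ?addn0 -?fr0 ?lt0n ?mf // => r ne_r.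
  apply/eqP; rewrite mnm1E eqb0; apply: contra ne_r => /eqP/(congr1 c).
  by rewrite !cf => /val_inj->.
by rewrite big1 // => r _; rewrite mnm1E f_v.
Qed.

(** The exchange stays inside one colour: two transversals have the same degree 1 in the colour of
    [p], so a drop at [p] is made up at some [q] of that colour. *)
Lemma linres_rainbow : linres t rainbow_ideal.
Proof.
apply: (@eq_linres _ _ _ _ (mono_ideal (multiple_of transversals))) => [f|].
  by apply: eq_mono_ideal => m; rewrite multiple_of_transversals.
apply: linres_polymatroidal => [m|m m'].
  by rewrite mem_transversals => /transversal_mnmP[].
rewrite !mem_transversals => Tm Tm' p lt_p.
have mp : m p != 0%N by rewrite -lt0n (leq_ltn_trans _ lt_p).
have lt_cp := transversal_mnm_colour Tm mp.
have [mt m1] := transversal_mnmP _ Tm; have [_ m'1] := transversal_mnmP _ Tm'.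
have [q /andP[/eqP cq lt_q]|noq] := pickP (fun q => (c q == c p) && (m q < m' q)%N).
  exists q => //; rewrite mem_transversals.
  have mE : (m - U_(p) + U_(p))%MM = m by rewrite submK // lep1mP.
  apply/transversal_mnmP; split=> [|r lt_r].
    by rewrite -mt -{2}mE !mdegD !mdeg1.
  by rewrite -(m1 r lt_r) -{2}mE !colour_degD !colour_deg1 cq.
have : (colour_deg (c p) m' < colour_deg (c p) m)%N.
  rewrite /colour_deg (bigD1 p) //= [in X in (_ < X)%N](bigD1 p) //= -addSn leq_add //.
  apply: leq_sum => q /andP[cq _]; rewrite leqNgt.
  by have := noq q; rewrite cq /= => ->.
by rewrite m1 // m'1.
Qed.

End ColouredIdeals.

(** * Stanley-Reisner ideals generated by transversals, and the Koszul obstruction *)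

Section RainbowIdeals.

Variables (F : fieldType) (n : nat) (c : 'I_n -> nat).
Local Notation S := {mpoly F[n]}.

Lemma prod_mpolyX (A : {set 'I_n}) :
  \prod_(v in A) 'X_v = 'X_[\sum_(v in A) U_(v)] :> S.
Proof.
by rewrite (big_morph (fun m => 'X_[m] : S) (@mpolyXD n F) (mpolyX0 n F)).
Qed.

Lemma mnm_sum_set (A : {set 'I_n}) w : (\sum_(v in A) U_(v))%MM w = (w \in A).
Proof.
rewrite mnm_sumE; case: (boolP (w \in A)) => [Aw|nAw].
  rewrite (bigD1 w) //= mnm1E eqxx big1 // => v /andP[_ ne_v].
  by rewrite mnm1E (negPf ne_v).
by rewrite big1 // => v Av; rewrite mnm1E; case: eqP Av nAw => // -> ->.
Qed.

(** A monomial meeting all colours is a multiple of the squarefree monomial on its support, and this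
    support is a nonface. *)
Lemma stanley_reisner_rainbow t (Delta : scomplex 'I_n) (f : S) :
    (forall A : {set 'I_n}, A \notin Delta <->
       forall r, (r < t)%N -> exists2 v, c v = r & v \in A) ->
  stanley_reisner_ideal F Delta f <-> rainbow_ideal t c f.
Proof.
move=> DeltaE; split.
  apply: ideal_gen_sub => [|g [A [/DeltaE cA ->]]].
    exact: rainbow_ideal_is_ideal.
  rewrite prod_mpolyX; apply/mono_idealX/rainbowP => r /cA[v cv Av].
  by exists v; rewrite // mnm_sum_set Av.
have idI := @ideal_gen_is_ideal S
  (fun f => exists A : {set 'I_n}, A \notin Delta /\ f = \prod_(v in A) 'X_v).
apply: (mono_ideal_sub idI) => m /rainbowP cm.
pose A := [set v | m v != 0%N].
have le_Am : (\sum_(v in A) U_(v) <= m)%MM.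
  by apply/mnm_lepP=> v; rewrite mnm_sum_set inE; case: (m v).
rewrite -(submK le_Am) mpolyXD; case: idI => _ _; apply.
apply: mem_ideal_gen; exists A; rewrite prod_mpolyX; split=> //.
by apply/DeltaE => r /cm[v cv mv]; exists v; rewrite ?inE.
Qed.

Lemma rainbow1_var_ideal (f : S) :
  rainbow_ideal 1 c f <-> var_ideal [set v | c v == 0%N] f.
Proof.
apply: eq_mono_ideal => m.
apply/rainbowP/exists_inP => [/(_ 0%N isT)[v cv mv]|[v]].
  by exists v; rewrite ?inE ?cv.
by rewrite inE => /eqP cv mv [|//] _; exists v.
Qed.

(* The signs of the Koszul cocycle +-X_i X_j; it is the image of 1 under the
   connecting morphisms of the exact sequence
   0 -> S/I -> (+) S/P_r -> (+) S/(P_r + P_s) -> S/(P_0 + P_1 + P_2) -> 0. *)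
Definition colour_sign (a b : nat) : F :=
  if (a == 1%N) && (b == 2%N) then 1
  else if (a == 2%N) && (b == 1%N) then -1 else 0.

(** If the three vertices have all three colours, X_i X_j X_k lies in the ideal; otherwise the
    alternating sum of signs vanishes. *)
Lemma colour_sign_cocycle i j k :
    (forall v, c v < 3)%N ->
  rainbow_ideal 3 c
    ('X_i * (colour_sign (c j) (c k) *: ('X_j * 'X_k))
     - 'X_j * (colour_sign (c i) (c k) *: ('X_i * 'X_k))
     + 'X_k * (colour_sign (c i) (c j) *: ('X_i * 'X_j)) : S).
Proof.
move=> c3; have [I0 _ IM] := rainbow_ideal_is_ideal F 3 c.
set e := colour_sign (c j) (c k) - colour_sign (c i) (c k) + colour_sign (c i) (c j).
rewrite (_ : _ + _ = e%:MP * 'X_[U_(i) + U_(j) + U_(k)]); last first.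
  by rewrite !mpolyXD /e mpolyCD mpolyCB -!mul_mpolyC; ring.
have [cijk|] := boolP [&& 0 \in [:: c i; c j; c k], 1 \in [:: c i; c j; c k]
  & 2 \in [:: c i; c j; c k]]%N.
  apply: IM; apply/mono_idealX/rainbowP => r lt_r.
  have: r \in [:: c i; c j; c k] by case/and3P: cijk; case: r lt_r => [|[|[|]]].
  rewrite !inE => /or3P[]/eqP->; [exists i|exists j|exists k] => //;
    by rewrite !mnmDE !mnm1E eqxx ?addn1 ?addn_eq0 //=; rewrite ?andbF.
move=> nc; suff -> : e = 0 by rewrite mpolyC0 mul0r.
rewrite /e /colour_sign; move: (c3 i) (c3 j) (c3 k) nc.
move: (c i) (c j) (c k) => [|[|[|?]]] [|[|[|?]]] [|[|[|?]]] //= _ _ _ _; ring.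
Qed.

(** A monomial of degree 2 meets at most two of the three colours. *)
Lemma rainbow3_coef i j (f : S) :
  rainbow_ideal 3 c f -> f@_(U_(i) + U_(j)) = 0.
Proof.
move=> If; apply: memN_msupp_eq0; apply/negP=> /If/rainbowP cm.
have {}cm r : (r < 3)%N -> (r == c i) || (r == c j).
  move/cm=> [v <-]; rewrite mnmDE !mnm1E addn_eq0 negb_and !eqb0 !negbK.
  by case/orP=> /eqP->; rewrite eqxx ?orbT.
by have := cm 0%N isT; have := cm 1%N isT; have := cm 2%N isT; lia.
Qed.

Lemma rainbow3_not_cohen_macaulay (I : S -> Prop) :
    (forall f, I f <-> rainbow_ideal 3 c f) -> (forall v, c v < 3)%N ->
    (forall r, (r < 3)%N -> exists v, c v = r) ->
    (2 < #|~: [set v | c v == 0%N]|)%N ->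
  ~ cohen_macaulay I.
Proof.
move=> IE c3 surj_c dim3 [d [[_ maxd] [[s [sd irrs regs]] _]]].
have idI : is_ideal I.
  have [I0 ID IM] := rainbow_ideal_is_ideal F 3 c.
  by split=> [|f g|f g]; rewrite !IE //; [apply: ID | apply: IM].
have sub0 f : I f -> var_ideal [set v | c v == 0%N] f.
  move/IE=> If m /If/rainbowP/(_ 0%N isT)[v cv mv].
  by apply/exists_inP; exists v; rewrite ?inE ?cv.
have [P /maxd le_d] := var_ideal_chain sub0.
have := regular_seq_local_chain irrs regs; rewrite sd.
have {le_d} := leq_trans dim3 le_d.
(* The depth equals the dimension, hence is at least 3, the length [koszul2] requires. *)
case: d {maxd sd} => [|[|[|d]]] // _ chainI.
pose g i j : S := colour_sign (c i) (c j) *: ('X_i * 'X_j).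
have [i j k|h Ih] := koszul2 (g := g) chainI.
  rewrite take0; apply/(ideal_add_nil _ idI)/IE; exact: colour_sign_cocycle.
(* Comparing coefficients of X_i X_j, the sign must be a difference of scalars attached to [j] and
   [i]. *)
have coefE i j : i != j -> colour_sign (c i) (c j) = (h j)@_U_(j) - (h i)@_U_(i).
  move=> ne_ij; have := Ih i j; rewrite take0 => /(ideal_add_nil _ idI)/IE.
  move/(rainbow3_coef i j)/eqP; rewrite mcoeffB subr_eq0 /g mcoeffZ -mpolyXD.
  rewrite mcoeffX eqxx mulr1 mcoeffB => /eqP->; congr (_ - _).
    by rewrite mulrC mcoeffMX.
  by rewrite addmC mulrC mcoeffMX.
have [v0 c0] := surj_c 0%N isT.
have [v1 c1] := surj_c 1%N isT; have [v2 c2] := surj_c 2%N isT.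
have ne_v v w : c v != c w -> v != w by apply: contra => /eqP->.
have := coefE v1 v2; have := coefE v0 v1; have := coefE v0 v2.
rewrite !ne_v ?c0 ?c1 ?c2 // /colour_sign /= => /(_ isT) E02 /(_ isT) E01 /(_ isT) E12.
(* The signs for colours (0, 1) and (0, 2) are 0, so the three scalars agree, whereas the sign for
   (1, 2) is 1. *)
have /eqP : (1 : F) = 0.
  by rewrite E12 -[RHS](subrr (0 : F)) {1}E02 E01; ring.
by rewrite oner_eq0.
Qed.

End RainbowIdeals.

(** * Independent sets in squares of paths and cycles *)

Section SpacedSets.

Variables (k n : nat) (M : {set 'I_n}).
Hypotheses (le_n3k : (n <= 3 * k)%N) (cardM : #|M| = k).
Hypothesis spacedM : {in M &, forall i j : 'I_n, (i < j)%N -> (i + 3 <= j)%N}.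

Lemma spaced_inj : {in M &, forall i j : 'I_n, (i %/ 3 = j %/ 3)%N -> i = j}.
Proof.
move=> i j Mi Mj eq_ij; apply: val_inj => /=; case: (ltngtP i j) => //.
  by move/(spacedM Mi Mj); lia.
by move/(spacedM Mj Mi); lia.
Qed.

(** Pigeonhole: [k] elements lie in distinct blocks of length 3, and there are at most [k]
    blocks. *)
Lemma spaced_block a : (a < k)%N -> exists2 v, v \in M & (v %/ 3 = a)%N.
Proof.
move=> lt_a; have lt_k (v : 'I_n) : (v %/ 3 < k)%N.
  by rewrite ltn_divLR // mulnC (leq_trans (ltn_ord v)).
pose f v := Ordinal (lt_k v).
have fM : f @: M = setT.
  apply/eqP; rewrite eqEcard subsetT cardsT card_ord card_in_imset ?cardM ?leqnn //.
  by move=> i j Mi Mj /(congr1 val); apply: spaced_inj.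
have /imsetP[v Mv /(congr1 val)/= ->] : Ordinal lt_a \in f @: M by rewrite fM inE.
by exists v.
Qed.

(** Consecutive blocks contain elements at distance at least 3, so the position inside the block
    never decreases. *)
Lemma spaced_residue_homo :
  {in M &, forall v w : 'I_n, (v %/ 3 <= w %/ 3)%N -> (v %% 3 <= w %% 3)%N}.
Proof.
move=> v w Mv Mw /subnKC; move: (_ - _)%N => d; elim: d w Mw => [|d IHd] w Mw wE.
  by rewrite (@spaced_inj v w) //; lia.
have [|u Mu uE] := @spaced_block (v %/ 3 + d)%N; first by have := ltn_ord w; lia.
apply: leq_trans (IHd u Mu (esym uE)) _.
have /(spacedM Mu Mw) : (u < w)%N by lia.
lia.
Qed.

Lemma spaced_residue_class r :
  {in M, forall v : 'I_n, (v %% 3 = r)%N} -> M = [set v : 'I_n | v %% 3 == r]%N.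
Proof.
move=> Mr; apply/setP=> v; rewrite inE; apply/idP/eqP => [/Mr//|vr].
have [|w Mw wE] := @spaced_block (v %/ 3)%N; first by have := ltn_ord v; lia.
suff -> : v = w by [].
by apply: val_inj; have := Mr w Mw; move: vr wE => /=; lia.
Qed.

End SpacedSets.

(** The bounds mean 3 k + r - 3 < n <= 3 k + r, so the class consists of r, r + 3, ..., r + 3 (k -
    1). *)
Lemma card_residue_class k n r :
    (r < 3)%N -> (3 * k + r <= n + 2 < 3 * k + r + 3)%N ->
  #|[set v : 'I_n | v %% 3 == r]%N| = k.
Proof.
move=> r3 nE; have lt_n (a : 'I_k) : (3 * a + r < n)%N by have := ltn_ord a; lia.
pose f a := Ordinal (lt_n a).
have -> : [set v : 'I_n | v %% 3 == r]%N = f @: setT.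
  apply/setP=> v; rewrite inE; apply/eqP/imsetP => [vr|[a _ ->]] /=; last by lia.
  have lt_k : (v %/ 3 < k)%N by have := ltn_ord v; lia.
  by exists (Ordinal lt_k) => //; apply: val_inj => /=; lia.
rewrite card_imset ?cardsT ?card_ord // => a b /(congr1 val)/= eq_ab.
by apply: val_inj => /=; lia.
Qed.

Lemma sqpath_ltE n (i j : 'I_n) : (i < j)%N -> sqpath n i j = (j < i + 3)%N.
Proof. by move=> lt_ij /=; rewrite /sqpath_rel; lia. Qed.

Lemma sqcycle_ltE n (i j : 'I_n) : (2 < n)%N -> (i < j)%N ->
  sqcycle n i j = (j < i + 3)%N || (i + n < j + 3)%N.
Proof.
move=> n3 lt_ij /=; rewrite /sqcycle_rel -val_eqE /=.
have modE m : (m < n + n)%N -> (m %% n = if (m < n)%N then m else m - n)%N.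
  move=> lt_m; case: ltnP => [/modn_small//|le_n].
  by rewrite -{1}(subnK le_n) modnDr modn_small //; lia.
have [lt_i lt_j] := (ltn_ord i, ltn_ord j).
rewrite !modE; [|lia..].
by case: (ltnP (i + 1) n); case: (ltnP (i + 2) n); case: (ltnP (j + 1) n);
  case: (ltnP (j + 2) n); lia.
Qed.

Lemma independent_ltP (T : nat) (G : sgraph 'I_T) (M : {set 'I_T}) :
  independent G M <-> {in M &, forall i j : 'I_T, (i < j)%N -> ~~ G i j}.
Proof.
split=> [/forall_inP indM i j Mi Mj _|indM]; first exact: (forall_inP (indM i Mi)).
apply/forall_inP=> i Mi; apply/forall_inP=> j Mj.
case: (ltngtP i j) => [|lt_ji|/val_inj->]; [exact: indM | | by rewrite adj_irr].
by rewrite adj_sym; apply: indM.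
Qed.

(** The last block contains only the vertex 3 k - 3, of residue 0; since residues never decrease
    along [M], all of them are 0. *)
Lemma independent_sqpath k (M : {set 'I_(3 * k - 2)}) : (0 < k)%N ->
  independent (sqpath (3 * k - 2)) M && (#|M| == k)
    <-> M = [set v : 'I_(3 * k - 2) | v %% 3 == 0]%N.
Proof.
move=> k_gt0; split=> [/andP[/independent_ltP indM /eqP cardM]|->].
  have spM : {in M &, forall i j : 'I_(3 * k - 2), (i < j)%N -> (i + 3 <= j)%N}.
    move=> i j Mi Mj lt_ij; have := indM i j Mi Mj lt_ij.
    by rewrite sqpath_ltE // -leqNgt.
  have le_n : (3 * k - 2 <= 3 * k)%N by lia.
  apply: (spaced_residue_class le_n cardM spM) => v Mv.
  have [|w Mw wE] := @spaced_block k _ _ le_n cardM spM k.-1; first by lia.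
  have := spaced_residue_homo le_n cardM spM Mv Mw.
  by have [lt_v lt_w] := (ltn_ord v, ltn_ord w); lia.
apply/andP; split; last by apply/eqP/card_residue_class; lia.
apply/independent_ltP=> i j; rewrite !inE => i0 j0 lt_ij.
by rewrite sqpath_ltE //; lia.
Qed.

(** Adjacency across the end bounds the last element [w] by [v0 + 3 * k - 3], so its residue is at
    most that of the first element [v0]. Residues never decrease, hence are constant. *)
Lemma independent_sqcycle k (M : {set 'I_(3 * k)}) : (1 < k)%N ->
  independent (sqcycle (3 * k)) M && (#|M| == k)
    <-> exists2 r, (r < 3)%N & M = [set v : 'I_(3 * k) | v %% 3 == r]%N.
Proof.
move=> k_gt1; have n3 : (2 < 3 * k)%N by lia.
split=> [/andP[/independent_ltP indM /eqP cardM]|[r r3 ->]].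
  have sp2M : {in M &, forall i j : 'I_(3 * k),
      (i < j)%N -> (i + 3 <= j)%N && (j + 3 <= i + 3 * k)%N}.
    move=> i j Mi Mj lt_ij; have := indM i j Mi Mj lt_ij.
    by rewrite sqcycle_ltE // negb_or -!leqNgt.
  have spM : {in M &, forall i j : 'I_(3 * k), (i < j)%N -> (i + 3 <= j)%N}.
    by move=> i j Mi Mj /(sp2M i j Mi Mj)/andP[].
  have block := spaced_block (leqnn _) cardM spM.
  have homo := spaced_residue_homo (leqnn _) cardM spM.
  have [|v0 Mv0 v0E] := block 0%N; first by lia.
  have [|w Mw wE] := block k.-1; first by lia.
  have lt_v0w : (v0 < w)%N by lia.
  have /andP[_ le_w] := sp2M v0 w Mv0 Mw lt_v0w.
  exists (v0 %% 3)%N; first by rewrite ltn_mod.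
  apply: (spaced_residue_class (leqnn _) cardM spM) => v Mv.
  have := homo v0 v Mv0 Mv; have := homo v w Mv Mw.
  by have lt_v := ltn_ord v; lia.
apply/andP; split; last by apply/eqP/card_residue_class; lia.
apply/independent_ltP=> i j; rewrite !inE => ir jr lt_ij.
by rewrite sqcycle_ltE //; have := ltn_ord j; lia.
Qed.

(** * Nonfaces of the total cut complexes, and the conclusion *)

Lemma total_cut_nonface (T : finType) k (G : sgraph T) (A : {set T}) :
  A \notin total_cut_complex k G <->
  forall M : {set T}, independent G M && (#|M| == k) -> exists2 v, v \in A & v \in M.
Proof.
rewrite inE; split=> [/exists_inPn nA M indM|AM].
  have /nA/subsetPn[v Av] :
      ~: M \in [set ~: M | M : {set T} & independent G M && (#|M| == k)].
    by apply: imset_f; rewrite inE.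
  by rewrite inE negbK; exists v.
apply/exists_inPn=> _ /imsetP[M + ->]; rewrite inE => /AM[v Av Mv].
by apply/subsetPn; exists v; rewrite // inE negbK.
Qed.

Definition residue n (v : 'I_n) : nat := (v %% 3)%N.

Lemma stanley_reisner_sqcycle (F : fieldType) k (f : {mpoly F[3 * k]}) : (1 < k)%N ->
  stanley_reisner_ideal F (total_cut_complex k (sqcycle (3 * k))) f <->
  rainbow_ideal 3 (@residue (3 * k)) f.
Proof.
move=> k_gt; apply: stanley_reisner_rainbow => A; rewrite total_cut_nonface.
split=> [AM r r3|cA M /(independent_sqcycle M k_gt)[r /cA[v vr Av] ->]].
  have [|v Av] := AM [set v : 'I_(3 * k) | v %% 3 == r]%N.
    by apply/independent_sqcycle=> //; exists r.
  by rewrite inE => /eqP; exists v.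
by exists v => //; rewrite inE; apply/eqP.
Qed.

Lemma stanley_reisner_sqpath (F : fieldType) k (f : {mpoly F[3 * k - 2]}) : (0 < k)%N ->
  stanley_reisner_ideal F (total_cut_complex k (sqpath (3 * k - 2))) f <->
  rainbow_ideal 1 (@residue (3 * k - 2)) f.
Proof.
move=> k_gt; apply: stanley_reisner_rainbow => A; rewrite total_cut_nonface.
split=> [AM [|//] _|/(_ 0%N isT)[v vr Av] M /(independent_sqpath M k_gt) ->].
  have [|v Av] := AM [set v : 'I_(3 * k - 2) | v %% 3 == 0]%N.
    exact/independent_sqpath.
  by rewrite inE => /eqP; exists v.
by exists v => //; rewrite inE; apply/eqP.
Qed.

Theorem theorem27 (F : fieldType) (k : nat) (hk : (2 <= k)%N) :
  let IC := stanley_reisner_ideal F (total_cut_complex k (sqcycle (3 * k))) in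
  let IL := stanley_reisner_ideal F (total_cut_complex k (sqpath (3 * k - 2))) in
  [/\ linear_resolution IC, linear_resolution IL,
      ~ cohen_macaulay IC & cohen_macaulay IL].
Proof.
move=> IC IL; have ICE f := @stanley_reisner_sqcycle F k f hk.
have ILE f := @stanley_reisner_sqpath F k f (ltnW hk); split.
- exists 3; split=> //; apply: linres_s_linear; apply: eq_linres ICE _.
  exact: linres_rainbow.
- exists 1%N; split=> //; apply: linres_s_linear; apply: eq_linres ILE _.
  exact: linres_rainbow.
(* As [k >= 2], the vertices 0, ..., 5 exist: 0, 1, 2 represent the residues, and 1, 2, 4 are three
   vertices of nonzero residue, so the dimension is at least 3. *)
- have lt_n a : (a < 6)%N -> (a < 3 * k)%N by lia.
  pose v a (a6 : (a < 6)%N) := Ordinal (lt_n a a6).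
  apply: rainbow3_not_cohen_macaulay ICE _ _ _ => [w|r r3|].
  + by rewrite ltn_mod.
  + have r6 : (r < 6)%N by apply: leq_trans r3 _.
    by exists (v r r6); apply: modn_small.
  have: [set v 1%N isT; v 2%N isT; v 4%N isT] \subset
      ~: [set w : 'I_(3 * k) | w %% 3 == 0]%N.
    by apply/subsetP=> w; rewrite !inE => /orP[/orP[]|] /eqP->.
  by move/subset_leq_card; apply: leq_trans; rewrite -setUA cardsU1 cards2 !inE.
- apply: (cohen_macaulay_var_ideal (W := [set v : 'I_(3 * k - 2) | v %% 3 == 0]%N)).
  by move=> f; apply: iff_trans (ILE f) _; apply: rainbow1_var_ideal.
Qed.
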